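(* Let $n,k,\ell$ be positive integers and let $b,b_1,\dots,b_n$ and $s_1,\dots,s_{\ell+1}$ be nonnegative integers with $\sum_{i=1}^n b_i=b$, $\sum_{i=1}^n i\,b_i\le n$, $\sum_{i=1}^{\ell+1}s_i=n$ and $s_1=n-b$. Then the number of multichains $\pi_1\le\pi_2\le\cdots\le\pi_\ell$ in $\widetilde{\mathrm{NC}}^{(2k)}(2n+1)$ with rank jump vector $(s_1,\dots,s_{\ell+1})$ and with $\mathrm{type}(\pi_1)=(b;b_1,\dots,b_n)$ equals $$\binom{b}{b_1,b_2,\dots,b_n}\binom{2kn+k}{s_2}\cdots\binom{2kn+k}{s_{\ell+1}}.$$
   Context: A partition of $[N]=\{1,\dots,N\}$ is noncrossing if there are no $a<b<c<d$ with $a,c$ in one block and $b,d$ in a different block. Let $m=k(2n+1)$ and $\rho(i)=i+m$ for $1\le i\le m$, $\rho(i)=i-m$ for $m<i\le 2m$ (the $180^\circ$ rotation of the circular representation of $[2m]$). $\widetilde{\mathrm{NC}}^{(2k)}(2n+1)$ is the set of noncrossing partitions of $[2k(2n+1)]$ whose block sizes are all divisible by $2k$ and which are invariant under $\rho$, ordered by refinement. For such $\pi$, let $p(\pi)$ be the number of unordered pairs $\{B,\rho(B)\}$ of blocks of $\pi$ with $\rho(B)\ne B$; the poset is graded with $\mathrm{rank}(\pi)=n-p(\pi)$, the maximum (one-block partition) having rank $n$. The type of $\pi$ is $(b;b_1,\dots,b_n)$ where $b_i$ is the number of such unordered pairs $\{B,\rho(B)\}$, $\rho(B)\neq B$, with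 $|B|=2ki$, and $b=b_1+\cdots+b_n$. For a multichain $\pi_1\le\cdots\le\pi_\ell$ (repetitions allowed) in a graded poset with maximum $\hat 1$, the rank jump vector is $(s_1,\dots,s_{\ell+1})$ with $s_1=\mathrm{rank}(\pi_1)$, $s_i=\mathrm{rank}(\pi_i)-\mathrm{rank}(\pi_{i-1})$ for $2\le i\le\ell$, $s_{\ell+1}=\mathrm{rank}(\hat1)-\mathrm{rank}(\pi_\ell)$. *)

(* Defs.v *)
From mathcomp Require Import all_boot all_order.
Set Implicit Arguments. Unset Strict Implicit. Unset Printing Implicit Defensive.

(* Ground set [2k(2n+1)] is represented 0-indexed as 'I_(2 * mm k n);
   element x : 'I_N stands for x+1 in [N]. *)
Definition mm (k n : nat) : nat := k * (2 * n + 1).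

Lemma ord_pos (N : nat) (x : 'I_N) : 0 < N.
Proof. exact: leq_ltn_trans (leq0n x) (ltn_ord x). Qed.

Definition rho (m : nat) (x : 'I_(2 * m)) : 'I_(2 * m) :=
  Ordinal (ltn_pmod (x + m) (ord_pos x)).

Section Defs.
Variables (k n : nat).
Local Notation T := ('I_(2 * mm k n)).

Definition noncrossing (P : {set {set T}}) : bool :=
  [forall B in P, forall B' in P, (B != B') ==>
    [forall a : T, forall b : T, forall c : T, forall d : T,
      ~~ [&& (a < b)%N, (b < c)%N, (c < d)%N, a \in B, c \in B, b \in B' & d \in B']]].

Definition ncT (P : {set {set T}}) : bool :=
  [&& partition P [set: T], noncrossing P,
      [forall B in P, (2 * k %| #|B|)%N] &
      [set (@rho (mm k n)) @: B | B : {set T} in P] == P].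

Definition refines (P Q : {set {set T}}) : bool :=
  [forall B in P, exists C in Q, B \subset C].

Definition pnum (P : {set {set T}}) : nat :=
  #|[set [set B; (@rho (mm k n)) @: B] | B : {set T} in P & (@rho (mm k n)) @: B != B]|.

Definition typei (P : {set {set T}}) (i : nat) : nat :=
  #|[set [set B; (@rho (mm k n)) @: B] | B : {set T} in P &
       ((@rho (mm k n)) @: B != B) && (#|B| == 2 * k * i)%N]|.

Definition typeb (P : {set {set T}}) : nat := \sum_(1 <= i < n.+1) typei P i.

Definition rank (P : {set {set T}}) : nat := n - pnum P.

Variable l : nat.

Definition pij (c : l.-tuple {set {set T}}) (j : nat) : {set {set T}} :=
  nth set0 c j.-1.

Definition multichain (c : l.-tuple {set {set T}}) : bool :=
  [forall i : 'I_l, ncT (tnth c i)] &&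
  [forall i : 'I_l, forall j : 'I_l, (i <= j)%N ==> refines (tnth c i) (tnth c j)].

Definition rjv (c : l.-tuple {set {set T}}) (j : nat) : nat :=
  if j == 1 then rank (pij c 1)
  else if (j <= l)%N then rank (pij c j) - rank (pij c j.-1)
  else n - rank (pij c l).

End Defs.

Definition multinomial (b : nat) (bs : nat -> nat) (n : nat) : nat :=
  b`! %/ \prod_(1 <= i < n.+1) (bs i)`!.

(* Main.v *)
(** A [rho]-invariant noncrossing partition of the [2m]-gon lifts to an [m]-periodic structure
    on the integers. It is determined by the word that records, at each [y] modulo [m], the
    size of the noncentral block whose first element is [y] (and 0 if there is none): [x] lies
    in the block opened at the nearest [y <= x] such that the letters on [[y, x]] add up to at
    least the length of that arc. Moreover [sigma <= pi] iff the word of [sigma], read along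
    each noncentral block of [pi], is a Lukasiewicz word. Reading words block by block, the sum
    over [sigma <= pi] of a function of the block sizes of [sigma] depends only on the block
    sizes of [pi]; summed over all size sequences of length [b'], it equals [C(m, b - b')]
    times the sum over all size sequences of length [b], by induction with Pascal's rule.
    Iterating from the top of the chain down to [pi_1] produces the product of binomials, and
    the sequences of [b] sizes with prescribed content are counted by the multinomial. Block
    sizes divisible by [2k] force a central block because [2k] does not divide [k(2n+1)]. *)

Require Import Defs.
From mathcomp Require Import all_boot all_order.
From mathcomp Require Import zify.
Set Implicit Arguments. Unset Strict Implicit. Unset Printing Implicit Defensive.

(** * Sums over words *)

(** The sum over the refinements of one partition is never evaluated; only its total over all size
    sequences of a given length is. Hence the induction along the chain carries an arbitrary
    function of size sequences: one step replaces [f] by [finer_sum m q f]. The chain ends below the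
    one-block partition, whose size sequence is empty, so there the total over size sequences is a
    single term. Sequences are used rather than multisets because the blocks of a partition may be
    read in any order, with the same result. The sums range over all structures with a nonempty
    central block. Divisibility by [2k] enters only through the type of [pi_1]: its counts add up to
    the number of noncentral pairs, so every noncentral size is some [2ki]; the central block
    follows because [2k] divides [2m], and coarser blocks are unions of these. The binomials thus
    see only [m = k(2n+1) = 2kn+k]. Positions are natural numbers; most shifts by [m] or [2m] keep a
    subtraction from truncating. *)

Section Words.
Variable M : nat.

Fixpoint wsum n (f : seq nat -> nat) : nat :=
  if n is n'.+1 then \sum_(x < M) wsum n' (fun w => f (nat_of_ord x :: w)) else f [::].

(* [wsum] sums over all words of length [n] on the letters [0, ..., M - 1], [psum] over those
   without the letter 0. *)
Fixpoint psum n (f : seq nat -> nat) : nat :=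
  if n is n'.+1 then \sum_(x < M | 0 < x) psum n' (fun w => f (nat_of_ord x :: w))
  else f [::].

Lemma eq_wsum n f g : (forall w, size w = n -> f w = g w) -> wsum n f = wsum n g.
Proof.
elim: n f g => [|n IHn] f g fg /=; first exact: fg.
by apply: eq_bigr => x _; apply: IHn => w sw; apply: fg; rewrite /= sw.
Qed.

Lemma eq_psum n f g : (forall w, size w = n -> all (leq 1) w -> f w = g w) ->
  psum n f = psum n g.
Proof.
elim: n f g => [|n IHn] f g fg /=; first exact: fg.
apply: eq_bigr => x x0; apply: IHn => w sw pw; apply: fg; rewrite /= ?sw //.
by rewrite x0.
Qed.

Lemma wsum0 n : wsum n (fun=> 0) = 0.
Proof. by elim: n => //= n IHn; rewrite big1. Qed.

Lemma psum0 n : psum n (fun=> 0) = 0.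
Proof. by elim: n => //= n IHn; rewrite big1. Qed.

Lemma psumZ b a f : psum b (fun d => a * f d) = a * psum b f.
Proof.
elim: b f => //= b IHb f; rewrite big_distrr /=; apply: eq_bigr => x _.
by rewrite IHb.
Qed.

Definition letters (w : seq nat) := [seq x <- w | 0 < x].

(* Lukasiewicz words started at height [h]: the height stays nonnegative and ends at 0. *)
Fixpoint luk h (w : seq nat) : bool :=
  if w is x :: w' then (0 < h + x) && luk (h + x).-1 w' else h == 0.

(* Cuts [w] into segments of lengths [cs], which must be Lukasiewicz words, followed by a
   remainder whose letters leave some position unused (the central block). *)
Fixpoint seg (cs : seq nat) (w : seq nat) : bool :=
  if cs is c :: cs' then luk 0 (take c w) && seg cs' (drop c w) else sumn w < size w.

Lemma seg_nil cs : seg cs [::] = false.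
Proof. by elim: cs => //= c cs ->. Qed.

Lemma seg_drop cs c w : size w <= c -> seg cs (drop c w) = false.
Proof. by move=> h; rewrite drop_oversize // seg_nil. Qed.

(** The offset [a] is what is already spent of the total, by letters read or by the height of an
    open segment. The strict bound leaves room for a central position. *)
Definition bsum b a n (f : seq nat -> nat) :=
  psum b (fun d => (a + sumn d < n) * f d).

Lemma bsumS b a n f :
  bsum b.+1 a n f = \sum_(x < M | 0 < x) bsum b (a + x) n (fun d => f (nat_of_ord x :: d)).
Proof.
by apply: eq_bigr => x _; apply: eq_psum => d _ _; rewrite /= addnA.
Qed.

Lemma bsum_shift b a n f : bsum b a.+1 n.+1 f = bsum b a n f.
Proof. by apply: eq_psum => d _ _; rewrite addSn ltnS. Qed.

Lemma bsum_out b a n f : n <= a -> bsum b a n f = 0.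
Proof.
move=> na; rewrite -[RHS](psum0 b); apply: eq_psum => d _ _.
by rewrite ltnNge (leq_trans na) ?leq_addr.
Qed.

Definition bweight b (f : seq nat -> nat) w := (size (letters w) == b) * f (letters w).

Lemma bweightS0 f x w : 0 < x -> bweight 0 f (x :: w) = 0.
Proof. by rewrite /bweight /= => ->. Qed.

Lemma bweightSS b f x w : 0 < x ->
  bweight b.+1 f (x :: w) = bweight b (fun d => f (x :: d)) w.
Proof. by rewrite /bweight /= => -> /=. Qed.

Lemma sum_split0 (F : 'I_M -> nat) (M0 : 0 < M) :
  \sum_x F x = F (Ordinal M0) + \sum_(x < M | 0 < x) F x.
Proof.
rewrite (bigD1 (Ordinal M0)) //=; congr addn; apply: eq_bigl => x.
by rewrite lt0n; apply/idP/idP; apply: contra; [move/eqP=> h; apply/eqP/val_inj|move/eqP->].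
Qed.

(** Without segments the nonzero letters choose their positions freely; Pascal's rule on whether the
    first letter is 0. *)
Lemma free_sum n b a n' f : 0 < M ->
  wsum n (fun w => (a + sumn w < n') * bweight b f w) = 'C(n, b) * bsum b a n' f.
Proof.
move=> M0; elim: n b a f => [|n IHn] b a f /=.
  by case: b => [|b] /=; rewrite /bweight /bsum /= ?mul1n ?muln0 ?mul0n.
rewrite (sum_split0 _ M0) /= IHn.
case: b => [|b].
  rewrite !bin0 big1 ?addn0 // => x x0.
  rewrite -[RHS](wsum0 n); apply: eq_wsum => w _.
  by rewrite bweightS0 // muln0.
rewrite binS mulnDl; congr addn.
rewrite bsumS big_distrr /=; apply: eq_bigr => x x0; rewrite -IHn.
by apply: eq_wsum => w _; rewrite bweightSS // addnA.
Qed.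

(** Truncated subtraction would give 1 for [b < b']. The right value is 0: each of the [b'] segments
    starts with a nonzero letter. *)
Definition binom_gap n b b' := if b' <= b then 'C(n, b - b') else 0.

Lemma binom_gapS n b b' : binom_gap n.+1 b.+1 b' = binom_gap n b.+1 b' + binom_gap n b b'.
Proof.
rewrite /binom_gap; case: (ltngtP b' b.+1) => [lt|gt|->].
- by rewrite -ltnS lt subSn // binS.
- by rewrite leqNgt (ltn_trans (ltnSn b) gt).
- by rewrite subnn ltnn !bin0.
Qed.

Definition cutsum b' n (g : seq nat -> nat) :=
  psum b' (fun cs => wsum n (fun w => seg cs w * g w)).

(* The first segment is being read: its height is [h] and its unread part has length [r]. *)
Definition opensum h b' n (g : seq nat -> nat) :=
  \sum_(r < M) psum b' (fun cs =>
     wsum n (fun w => (luk h (take r w) && seg cs (drop r w)) * g w)).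

Lemma eq_opensum h b' n g1 g2 : g1 =1 g2 -> opensum h b' n g1 = opensum h b' n g2.
Proof.
move=> g12; apply: eq_bigr => r _; apply: eq_psum => cs _ _.
by apply: eq_wsum => w _; rewrite g12.
Qed.

(** Reading a letter [x] shortens the open part by one and changes the height by [x - 1]. Shifting
    the range of [r] is possible because [r = M] contributes 0: it leaves no position for the
    central remainder. *)
Lemma opensum_tail h b' n g : n < M ->
  \sum_(r < M | 0 < r) psum b' (fun cs => wsum n.+1 (fun w =>
     (luk h (take r w) && seg cs (drop r w)) * g w)) =
  \sum_(x < M | 0 < h + x) opensum (h + x).-1 b' n (fun w => g (nat_of_ord x :: w)).
Proof.
move=> ltnM; have M0 : 0 < M by exact: leq_ltn_trans ltnM.
pose G r := psum b' (fun cs => wsum n.+1 (fun w =>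
     (luk h (take r w) && seg cs (drop r w)) * g w)).
have GM : G M = 0.
  rewrite /G -[RHS](psum0 b'); apply: eq_psum => cs _ _.
  rewrite -[RHS](wsum0 n.+1); apply: eq_wsum => w sw.
  by rewrite seg_drop ?sw // andbF.
transitivity (\sum_(r < M) G r.+1).
  have : \sum_(i < M.+1) G i = \sum_(i < M) G i by rewrite big_ord_recr /= GM addn0.
  rewrite big_ord_recl /= (sum_split0 (fun i : 'I_M => G i) M0) /=.
  by move=> /addnI.
rewrite /G /=.
rewrite [RHS](_ : _ = \sum_(x < M | 0 < h + x) \sum_(r < M) psum b' (fun cs =>
     wsum n (fun w => (luk (h + x).-1 (take r w) && seg cs (drop r w))
        * g (nat_of_ord x :: w)))) //.
rewrite exchange_big /=; apply: eq_bigr => r _.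
rewrite (eq_psum (g := fun cs => \sum_(x < M | 0 < h + x) wsum n (fun w =>
  (luk (h + x).-1 (take r w) && seg cs (drop r w)) * g (nat_of_ord x :: w)))); last first.
  move=> cs _ _; rewrite [RHS]big_mkcond; apply: eq_bigr => x _.
  case: ifP => hx; last first.
    by rewrite -[RHS](wsum0 n); apply: eq_wsum.
  by apply: eq_wsum.
elim: b' {G GM} (seg) => [|b' IHb] sg //=.
rewrite exchange_big; apply: eq_bigr => c _ /=.
exact: (IHb (fun cs => sg (nat_of_ord c :: cs))).
Qed.

Lemma opensumS h b' n g : n < M ->
  opensum h b' n.+1 g = (h == 0) * cutsum b' n.+1 g +
  \sum_(x < M | 0 < h + x) opensum (h + x).-1 b' n (fun w => g (nat_of_ord x :: w)).
Proof.
move=> ltnM; have M0 : 0 < M by exact: leq_ltn_trans ltnM.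
rewrite -opensum_tail // /opensum (sum_split0 _ M0); congr addn.
rewrite -psumZ; apply: eq_psum => cs _ _.
rewrite (@eq_wsum _ _ (fun w => (h == 0) * (seg cs w * g w))); last first.
  by move=> w _; rewrite [take _ w]take0 [drop _ w]drop0 /=; case: eqP; rewrite ?mul1n ?mul0n.
by case: (h == 0); rewrite ?mul1n ?mul0n ?wsum0 //; apply: eq_wsum => w _; rewrite mul1n.
Qed.

Lemma cutsumS b' n g : n < M -> cutsum b'.+1 n.+1 g =
  \sum_(x < M | 0 < x) opensum x.-1 b' n (fun w => g (nat_of_ord x :: w)).
Proof. by move=> ltnM; rewrite -(@opensum_tail 0). Qed.

Lemma opensum0 h b' n : opensum h b' n (fun=> 0) = 0.
Proof.
rewrite /opensum big1 // => r _; rewrite -[RHS](psum0 b'); apply: eq_psum => cs _ _.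
by rewrite -[RHS](wsum0 n); apply: eq_wsum => w _; rewrite muln0.
Qed.

Lemma opensum_letter h b' n b f (e := binom_gap n.+1) : n <= M ->
  (forall h b b' f, opensum h b' n (bweight b f) = e b b' * bsum b h.+1 n.+1 f) ->
  \sum_(x < M | 0 < x) opensum (h + x).-1 b' n (fun w => bweight b f (nat_of_ord x :: w))
  = (0 < b) * e b.-1 b' * bsum b h n.+1 f.
Proof.
move=> nM IH; case: b => [|b].
  rewrite mul0n big1 // => x x0; rewrite -[RHS](opensum0 (h + x).-1 b' n).
  by apply: eq_opensum => w; rewrite bweightS0.
rewrite mul1n bsumS big_distrr; apply: eq_bigr => x x0 /=.
rewrite (eq_opensum _ _ _ (g2 := bweight b (fun d => f (nat_of_ord x :: d)))); last first.
  by move=> w; rewrite bweightSS.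
by rewrite IH prednK // addn_gt0 x0 orbT.
Qed.

(** A height [h] acts as [h] units taken from the total, which makes the two sums provable together.
    In the Pascal step positive first letters give the term at [b - 1]. The term at [b] comes from
    the letter 0 when the height is positive, and from closing the segment when the height is 0,
    where the letter 0 is forbidden. *)
Lemma open_cut_sum n : n <= M ->
  (forall h b' b f, opensum h b' n (bweight b f) = binom_gap n.+1 b b' * bsum b h.+1 n.+1 f) /\
  (forall b' b f, cutsum b' n (bweight b f) = binom_gap n b b' * bsum b 0 n f).
Proof.
elim: n => [|n IHn] leM.
  split=> [h b' b f|b' b f].
    rewrite bsum_shift bsum_out // muln0 /opensum big1 // => r _.
    rewrite -[RHS](psum0 b'); apply: eq_psum => cs _ _ /=.
    by rewrite seg_nil andbF.
  rewrite bsum_out // muln0 /cutsum -[RHS](psum0 b'); apply: eq_psum => cs _ _ /=.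
  by rewrite seg_nil.
have [IHo _] := IHn (ltnW leM); have M0 : 0 < M by exact: leq_ltn_trans leM.
have IHo' h b b' f := IHo h b' b f.
have lett h b' b f := @opensum_letter h b' n b f (ltnW leM) IHo'.
have cut b' b f : cutsum b' n.+1 (bweight b f) = binom_gap n.+1 b b' * bsum b 0 n.+1 f.
  case: b' => [|b'].
    have -> : binom_gap n.+1 b 0 = 'C(n.+1, b) by rewrite /binom_gap leq0n subn0.
    rewrite -free_sum //; apply: eq_wsum => w sw /=.
    by rewrite sw.
  rewrite cutsumS //; have := lett 0 b' b f; rewrite /= => ->.
  by case: b => [|b]; rewrite ?mul0n // mul1n /binom_gap ltnS subSS.
split=> // h b' b f; rewrite opensumS // cut.
case: h => [|h].
  by rewrite lett eqxx mul1n -mulnDl bsum_shift; congr (_ * _);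
    case: b => [|b]; rewrite ?binom_gapS ?mul1n // mul0n addn0 /binom_gap; case: b'.
rewrite mul0n add0n (eq_bigl predT); last by move=> x; rewrite addSn.
rewrite (sum_split0 _ M0) /= addn0.
rewrite (eq_opensum _ _ _ (g2 := bweight b f)) // IHo; have := lett h.+1 b' b f; rewrite /= => ->.
rewrite -mulnDl bsum_shift.
congr (_ * _).
by case: b => [|b]; rewrite ?binom_gapS ?mul1n // mul0n addn0 /binom_gap; case: b'.
Qed.

End Words.

(** * Periodic noncrossing structures *)

Section Offsets.
Variable m : nat.
Implicit Types (o : nat -> option nat) (w : nat -> nat).

(* [o z = Some t] means that [z - t] is the first element of the lifted block of [z], and
   [o z = None] that [z] lies in the central block. *)
Definition opens o y z := (y <= z) && (o z == Some (z - y)).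

(** The last clause says at once that arcs do not cross and that no central element lies under an
    arc. *)
Definition nested o :=
  [/\ forall x, o (x + m) = o x, forall x t, o x = Some t -> t < m &
   forall y z u, opens o y z -> y <= u <= z -> exists2 y', y <= y' & opens o y' u].

Definition owidth o y := \sum_(y <= z < y + m) opens o y z.

Definition lukasiewicz o w :=
  (forall y q, \sum_(y <= z < q | opens o y z) 1 <= \sum_(y <= z < q | opens o y z) w z)
  /\ (forall y, \sum_(y <= z < y + m | opens o y z) w z
               = \sum_(y <= z < y + m | opens o y z) 1).

Definition nearest w x y :=
  [/\ y <= x, x.+1 - y <= \sum_(y <= z < x.+1) w z &
   forall y', y < y' <= x -> \sum_(y' <= z < x.+1) w z < x.+1 - y'].

(** The coarser one is [o2]. Comparing elements with their openers handles the noncentral blocks of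
    [o1]; the second clause puts the central block of [o1] inside that of [o2]. *)
Definition coarser o1 o2 :=
  (forall a x, opens o1 a x -> forall b, opens o2 b a = opens o2 b x)
  /\ (forall b x, opens o2 b x -> exists a, opens o1 a x).

Lemma opens_inj o y y' z : opens o y z -> opens o y' z -> y = y'.
Proof. by move=> /andP[h1 /eqP e1] /andP[h2]; rewrite e1 => /eqP[]; lia. Qed.

Lemma opens_le o y z : opens o y z -> y <= z.
Proof. by case/andP. Qed.

Lemma opens_lt o y z : nested o -> opens o y z -> z < y + m.
Proof. by case=> _ lt _ /andP[h /eqP/lt]; lia. Qed.

Lemma opens_self o y z : nested o -> opens o y z -> opens o y y.
Proof.
case=> _ _ nest yz; have [|y' h1 h2] := nest y z y yz; first by rewrite leqnn (opens_le yz).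
have E : y' = y by have := opens_le h2; lia.
by rewrite E in h2.
Qed.

Lemma opens_add o y z c : nested o -> opens o (y + c * m) (z + c * m) = opens o y z.
Proof.
case=> per _ _; have perc : o (z + c * m) = o z.
  by elim: c => [|c IH]; rewrite ?addn0 // mulSn [m + _]addnC addnA per.
by rewrite /opens perc leq_add2r subnDr.
Qed.

Lemma owidth_opens o y : nested o -> 0 < owidth o y -> opens o y y.
Proof.
move=> no; rewrite /owidth; case E: (opens o y y) => // h.
suff: \sum_(y <= z < y + m) opens o y z = 0 by lia.
rewrite big1_seq // => z _; case E2: (opens o y z) => //.
by rewrite (opens_self no E2) in E.
Qed.

Lemma sum_by_opener o (F : nat -> nat) a p q :
  (forall z, p <= z < q -> exists2 y, a <= y & opens o y z) ->
  \sum_(p <= z < q) F z = \sum_(a <= y < q) \sum_(p <= z < q | opens o y z) F z.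
Proof.
move=> cov; rewrite [RHS](_ : _ = \sum_(a <= y < q) \sum_(p <= z < q) opens o y z * F z); last first.
  apply: eq_bigr => y _; rewrite big_mkcond; apply: eq_bigr => z _.
  by case: ifP; rewrite ?mul1n ?mul0n.
rewrite exchange_big; apply: eq_big_nat => z pzq.
have [y ay yz] := cov z pzq; have := opens_le yz => yz'.
rewrite (bigD1_seq y) ?iota_uniq ?mem_index_iota //=; last by lia.
rewrite yz mul1n big1_seq ?addn0 // => y' /andP[ne _].
case E: (opens o y' z) => //.
by rewrite (opens_inj E yz) eqxx in ne.
Qed.

(** Prefixes have a surplus of letters over positions and the whole block balances, so suffixes have
    a deficit. *)
Lemma luk_suffix o w y p : lukasiewicz o w -> y <= p <= y + m ->
  \sum_(p <= z < y + m | opens o y z) w z <= \sum_(p <= z < y + m | opens o y z) 1.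
Proof.
case=> h1 h2 /andP[yp pm]; have := h2 y; have := h1 y p.
rewrite !(big_cat_nat (n := p) (m := y) (p := y + m)) //=; lia.
Qed.

Lemma sum1_nat p q : \sum_(p <= z < q) 1 = q - p.
Proof. by rewrite sum_nat_const_nat muln1. Qed.

Lemma sum_opens_ext o (F : nat -> nat) y p q r :
  (forall z, p <= z -> opens o y z -> (z < q) = (z < r)) ->
  \sum_(p <= z < q | opens o y z) F z = \sum_(p <= z < r | opens o y z) F z.
Proof.
move=> h; wlog qr : q r h / q <= r.
  by move=> W; have [/W|/ltnW/W] := leqP q r; [apply|move=> ->// z; move=> *; rewrite h].
have [pq|qp] := leqP p q.
  rewrite (big_cat_nat (n := q) (p := r)) //= [X in _ + X]big1_seq ?addn0 // => z.
  by rewrite mem_index_iota => /andP[/h]; lia.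
rewrite big_geq ?(ltnW qp) // big1_seq // => z.
by rewrite mem_index_iota => /andP[/h]; lia.
Qed.

(** The arc splits into a prefix of the block of [y], which has a surplus, and whole blocks, which
    balance: a block opened under the arc cannot reach past [x], whose opener is [y]. *)
Lemma luk_arc o w y x : nested o -> lukasiewicz o w -> opens o y x ->
  x.+1 - y <= \sum_(y <= z < x.+1) w z.
Proof.
move=> no Lw yx; have [_ _ nest] := no; have [L1 L2] := Lw.
have cov z : y <= z < x.+1 -> exists2 y', y <= y' & opens o y' z.
  by rewrite ltnS; apply: nest.
rewrite -sum1_nat (sum_by_opener (fun=> 1) cov) (sum_by_opener w cov) !big_nat; apply: leq_sum => y' /andP[yy' y'x].
have [->|ne] := eqVneq y' y; first exact: L1.
have E (F : nat -> nat) : \sum_(y <= z < x.+1 | opens o y' z) F z =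
    \sum_(y' <= z < y' + m | opens o y' z) F z.
  rewrite (big_cat_nat (n := y')) //=; last by lia.
  rewrite big1_seq ?add0n; last by move=> z /andP[/opens_le]; rewrite mem_index_iota; lia.
  apply: sum_opens_ext => z _ oz; rewrite (opens_lt no oz) ltnS.
  case: leqP => // xz; have [|y2 h1 h2] := nest _ _ x oz; first by lia.
  by have := opens_inj yx h2; lia.
by rewrite !E L2.
Qed.

Lemma nearest_exists w a x : a <= x -> x.+1 - a <= \sum_(a <= z < x.+1) w z ->
  exists2 y, a <= y & nearest w x y.
Proof.
move=> ax h.
pose P y := (y <= x) && (x.+1 - y <= \sum_(y <= z < x.+1) w z).
have exP : exists y, P y by exists a; rewrite /P ax.
have ubP y : P y -> y <= x by case/andP.
case: (ex_maxnP exP ubP) => y /andP[yx hy] mx.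
exists y; first by apply: mx; rewrite /P ax.
split=> // y' /andP[yy' y'x]; rewrite ltnNge; apply/negP => hy'.
by have := mx y'; rewrite /P y'x hy'; lia.
Qed.

Lemma nearest_pos w x y : nearest w x y -> 0 < w y.
Proof.
case=> yx h1 h2; rewrite big_ltn // in h1.
have [E|ne] := eqVneq y x; first by move: h1; rewrite E big_geq // ; lia.
by have := h2 y.+1; lia.
Qed.

(* The matched opener never leaves the block: the part of the arc from [y] to the end of its
   block is a union of block suffixes, which cannot carry more letters than positions. *)
Lemma luk_nearest o w x y : nested o -> lukasiewicz o w -> nearest w x y ->
  forall a, opens o a y = opens o a x.
Proof.
move=> no Lw near; have [yx y1 y2] := near; have [_ _ nest] := no.
have back b : opens o b x -> b <= y.
  move=> bx; rewrite leqNgt; apply/negP => yb.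
  by have := y2 b; have := luk_arc no Lw bx; have := opens_le bx; lia.
have fwd a : opens o a y -> opens o a x.
  move=> ay; have ay' := opens_le ay.
  pose P z := opens o a z.
  have exP : exists z, P z by exists y.
  have ubP z : P z -> z <= a + m by move/(opens_lt no)/ltnW.
  case: (ex_maxnP exP ubP) => q aq mx.
  have yq := mx _ ay; have aq' := opens_le aq.
  have [qx|xq] := ltnP q x; last first.
    have [|b ab bx] := nest a q x aq; first by lia.
    have by' := back _ bx.
    have [|c bc cy] := nest b x y bx; first by lia.
    by have := opens_inj ay cy => ?; have -> : a = b by lia.
  have cov z : y <= z < q.+1 -> exists2 y', a <= y' & opens o y' z.
    by move=> ?; apply: (nest a q) => //; lia.
  (* With at most this much spent up to [q], the letters on [[q + 1, x]] reach the length of that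
     arc, against the choice of [y] as nearest. *)
  suff: \sum_(y <= z < q.+1) w z <= q.+1 - y.
    move=> le; have := y2 q.+1; move: y1.
    rewrite (big_cat_nat (n := q.+1)) //=; lia.
  rewrite -sum1_nat (sum_by_opener (fun=> 1) cov) (sum_by_opener w cov) !big_nat; apply: leq_sum => b /andP[ab bq].
  pose p := maxn y b.
  have pb : b <= p by rewrite leq_maxr.
  have [pm|mp] := leqP p (b + m); last first.
    rewrite big1_seq // => z /andP[/(opens_lt no) h]; rewrite mem_index_iota; lia.
  have E (F : nat -> nat) : \sum_(y <= z < q.+1 | opens o b z) F z =
      \sum_(p <= z < b + m | opens o b z) F z.
    rewrite (big_cat_nat (n := p)) //=; [|by rewrite leq_maxl|by lia].
    rewrite big1_seq ?add0n; last by move=> z /andP[/opens_le]; rewrite mem_index_iota; lia.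
    apply: sum_opens_ext => z _ oz; rewrite (opens_lt no oz) ltnS.
    have [E|ne] := eqVneq a b; first by apply: mx; rewrite /P E.
    case: leqP => // xz; have [|y3 h1 h2] := nest _ _ q oz; first by lia.
    by have := opens_inj aq h2; lia.
  by rewrite !E; apply: luk_suffix => //; rewrite pb.
move=> a; apply/idP/idP => [/fwd//|ax].
have [|c bc cy] := nest a x y ax; first by have := back _ ax; lia.
by rewrite (opens_inj ax (fwd _ cy)).
Qed.

Lemma owidth_sum o y N : nested o -> y + m <= N ->
  owidth o y = \sum_(0 <= z < N) opens o y z.
Proof.
move=> no leN; rewrite (big_cat_nat (n := y)) //=; last by lia.
rewrite (big_cat_nat (n := y + m) (m := y)) //= ?leq_addr //.
rewrite big1_seq ?add0n; last first.
  by move=> z; rewrite mem_index_iota /opens; case: leqP => //; lia.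
rewrite [X in _ + X]big1_seq ?addn0 // => z; rewrite mem_index_iota => h.
by case E: (opens o y z) => //; have := opens_lt no E; lia.
Qed.

Lemma opens_owidth o y p q : nested o -> \sum_(p <= z < q) opens o y z <= owidth o y.
Proof.
move=> no; have [pq|/ltnW qp] := leqP p q; last by rewrite big_geq.
rewrite (@owidth_sum _ _ (q + (y + m))) ?leq_addl //.
rewrite [X in _ <= X](big_cat_nat (n := p)) //=; last by lia.
rewrite [X in _ + X](big_cat_nat (n := q)) //= ?leq_addr //; lia.
Qed.

(** Each position of a block of [o2] is counted in the width of its [o1]-opener, which lies in the
    same block and no later: prefixes have a surplus. The whole block balances since a block of [o1]
    opened in it stays in it. *)
Lemma coarser_luk o1 o2 : nested o1 -> nested o2 -> coarser o1 o2 ->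
  lukasiewicz o2 (owidth o1).
Proof.
move=> n1 n2 [c1 c2].
have L1 y q : \sum_(y <= z < q | opens o2 y z) 1 <=
    \sum_(y <= z < q | opens o2 y z) owidth o1 z.
  apply: (@leq_trans (\sum_(y <= z < q) \sum_(y <= z' < q | opens o2 y z') opens o1 z' z)).
    rewrite big_mkcond !big_nat; apply: leq_sum => z yzq; case: ifP => // yz.
    have [a az] := c2 _ _ yz; have ya : opens o2 y a by rewrite (c1 _ _ az).
    rewrite [X in _ <= X]big_mkcond (bigD1_seq a) ?iota_uniq //= ?mem_index_iota ?ya ?az //.
    by have := opens_le az; have := opens_le ya; lia.
  rewrite exchange_big /=; apply: leq_sum => a _; exact: opens_owidth.
split=> // y; apply/eqP; rewrite eqn_leq L1 andbT.
apply: (@leq_trans (\sum_(y <= z < y + m | opens o2 y z)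
    \sum_(y <= a < y + m | opens o2 y a) opens o1 a z)).
  rewrite exchange_big /=; apply: leq_sum => a ya.
  rewrite (@owidth_sum _ _ (y + m + (a + m))) ?leq_addl //.
  rewrite (big_cat_nat (n := y)) //=; last by lia.
  rewrite (big_cat_nat (n := y + m) (m := y)) //= ?leq_addr //.
  rewrite big1_seq ?add0n; last first.
    move=> z; rewrite mem_index_iota => h; case E: (opens o1 a z) => //.
    by have := opens_le E; have := opens_le ya; lia.
  rewrite [X in _ + X]big1_seq ?addn0; last first.
    move=> z; rewrite mem_index_iota => h; case E: (opens o1 a z) => //.
    by move: ya; rewrite (c1 _ _ E) => /(opens_lt n2); lia.
  rewrite [X in _ <= X]big_mkcond; apply: leq_sum => z _.
  by case E: (opens o1 a z) => //; rewrite -(c1 _ _ E) ya.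
apply: leq_sum => z yz; have [a az] := c2 _ _ yz.
rewrite (eq_bigr (fun a' => (a' == a) : nat)); last first.
  move=> a' _; case E: (opens o1 a' z); first by rewrite (opens_inj E az) eqxx.
  by case: eqP E => // ->; rewrite az.
rewrite big_mkcond /=.
apply: (@leq_trans (\sum_(y <= a' < y + m) (a' == a))).
  by apply: leq_sum => a' _; case: ifP.
have [h|h] := boolP (a \in index_iota y (y + m)).
  rewrite (bigD1_seq a) ?iota_uniq //= eqxx big1 // => i /negbTE->//.
by rewrite big1_seq // => i hi; case: eqP => // E; rewrite E (negbTE h) in hi.
Qed.

Lemma coarser_refl o : nested o -> coarser o o.
Proof.
move=> no; split=> [a x ax b|b x bx]; last by exists b.
apply/idP/idP => [ba|bx]; first by rewrite (opens_inj ba (opens_self no ax)).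
by rewrite -(opens_inj ax bx) (opens_self no ax).
Qed.

(** A structure refines itself, so its own widths are Lukasiewicz along its blocks. Hence the
    nearest-arc rule returns its openers, and the word determines the structure. *)
Lemma nearest_opens o x a : nested o -> nearest (owidth o) x a <-> opens o a x.
Proof.
move=> no; have L := coarser_luk no no (coarser_refl no).
have imp y : nearest (owidth o) x y -> opens o y x.
  move=> ny; rewrite -(luk_nearest no L ny).
  by apply: owidth_opens no _; apply: nearest_pos ny.
split; first exact: imp.
move=> ax; have [y _ ny] := nearest_exists (opens_le ax) (luk_arc no L ax).
by rewrite (opens_inj ax (imp _ ny)).
Qed.

Lemma luk_coarser o1 o2 : nested o1 -> nested o2 -> lukasiewicz o2 (owidth o1) ->
  coarser o1 o2.
Proof.
move=> n1 n2 L; split=> [a x /(nearest_opens _ _ n1) h b|b x bx].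
  exact: luk_nearest L h b.
have [y _ /(nearest_opens _ _ n1) ny] := nearest_exists (opens_le bx) (luk_arc n2 L bx).
by exists y.
Qed.

Lemma owidth_inj o1 o2 : nested o1 -> nested o2 -> owidth o1 =1 owidth o2 ->
  forall a x, opens o1 a x = opens o2 a x.
Proof.
move=> n1 n2 E a x.
have near : nearest (owidth o1) x a <-> nearest (owidth o2) x a.
  by split=> -[h1 h2 h3]; split=> // [|y /h3]; move: h2;
    rewrite ?(eq_bigr _ (fun i _ => E i)) // -?(eq_bigr _ (fun i _ => E i)).
by apply/idP/idP => /nearest_opens h; apply/nearest_opens => //; apply/near/h.
Qed.

End Offsets.

(** * Every word of small sum is realized *)

Section Existence.
Variable m : nat.
Implicit Types (o : nat -> option nat) (w : nat -> nat).

Lemma per_mul (T : Type) (F : nat -> T) (a c : nat) :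
  (forall x, F (x + m) = F x) -> F (a + c * m) = F a.
Proof.
by move=> per; elim: c => [|c IH]; rewrite ?addn0 // mulSn [m + _]addnC addnA per.
Qed.

Lemma per_mod (T : Type) (F : nat -> T) (a : nat) :
  (forall x, F (x + m) = F x) -> F (a %% m) = F a.
Proof. by move=> per; rewrite [in RHS](divn_eq a m) addnC per_mul. Qed.

Lemma per_modDl (T : Type) (F : nat -> T) a i :
  (forall x, F (x + m) = F x) -> F (a %% m + i) = F (a + i).
Proof. by move=> per; rewrite -per_mod // modnDml per_mod. Qed.

Lemma per_sum (F : nat -> nat) a : (forall x, F (x + m) = F x) ->
  \sum_(0 <= i < m) F (a + i) = \sum_(0 <= i < m) F i.
Proof.
move=> per; elim: a => [|a <-] //.
have E1 : \sum_(0 <= i < m.+1) F (a + i) = F a + \sum_(0 <= i < m) F (a.+1 + i).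
  by rewrite big_nat_recl // addn0; congr addn; apply: eq_bigr => i _; rewrite addnS.
by move: E1; rewrite big_nat_recr //= per addnC => /addnI.
Qed.

Lemma sum_shift (F : nat -> nat) a n :
  \sum_(a <= z < a + n) F z = \sum_(0 <= i < n) F (a + i).
Proof.
by rewrite -{1}[a]add0n big_addn addKn; apply: eq_bigr => i _; rewrite addnC.
Qed.

Lemma owidthE o y : owidth m o y = \sum_(0 <= i < m) (o (y + i) == Some i).
Proof.
rewrite /owidth -{1}[y]add0n big_addn addKn; apply: eq_bigr => i _.
by rewrite /opens leq_addl addnK addnC.
Qed.

Lemma owidth_per o y : (forall x, o (x + m) = o x) -> owidth m o (y + m) = owidth m o y.
Proof. by move=> per; rewrite !owidthE; apply: eq_bigr => i _; rewrite addnAC per. Qed.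

Lemma owidth_total o : nested m o ->
  \sum_(0 <= y < m) owidth m o y + \sum_(0 <= z < m) (o z == None) = m.
Proof.
case=> per lt _; rewrite (eq_bigr _ (fun y _ => owidthE o y)) exchange_big /=.
rewrite (eq_bigr (fun i => \sum_(0 <= z < m) (o z == Some i : nat))); last first.
  move=> i _; rewrite -[RHS](per_sum (F := fun z => (o z == Some i : nat)) i); last first.
    by move=> x; rewrite per.
  by apply: eq_bigr => z _; rewrite addnC.
rewrite exchange_big -big_split /= -[RHS]subn0 -sum1_nat.
apply: eq_bigr => z _; case E: (o z) => [t|] /=.
  rewrite addn0 (bigD1_seq t) ?iota_uniq ?mem_index_iota ?(lt _ _ E) //= eqxx.
  by rewrite big1 // => i ne; case: eqP => // -[E']; rewrite E' eqxx in ne.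
by rewrite big1.
Qed.

(** This gives the size of a block made of the next [c] central elements. *)
Lemma count_first (P : pred nat) c n :
  \sum_(0 <= i < n) (P i && (\sum_(0 <= j < i) P j < c)) = minn c (\sum_(0 <= i < n) P i).
Proof.
elim: n => [|n IHn]; first by rewrite !big_nil minn0.
rewrite !big_nat_recr //= IHn; case: (P n) => /=; last by rewrite !addn0.
by case: ltnP; lia.
Qed.

(* A letter [x] not covered by any earlier one; it exists because the word has negative drift
   over a period. *)
Lemma exists_record w : 0 < m -> (forall x, w (x + m) = w x) ->
  0 < \sum_(0 <= z < m) w z < m ->
  exists x, [/\ m <= x, 0 < w x & forall y, y <= x -> \sum_(y <= z < x) w z <= x - y].
Proof.
move=> m0 per /andP[S0 Sm].
(* Letters minus positions, raised by [2 * m] to stay natural. No arc ending just before a minimum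
   [j] overhangs it; the drop of [H] over one period excludes [j <= m]. *)
pose H (j : 'I_(2 * m).+1) := \sum_(0 <= z < j) w z + (2 * m - j).
case: (@arg_minnP _ ord0 xpredT H isT) => j _ jmin.
have mj : m < j.
  rewrite ltnNge; apply/negP => jm.
  have lt : j + m < (2 * m).+1 by lia.
  have := jmin (Ordinal lt) isT; rewrite /H /=.
  rewrite (big_cat_nat (n := j) (p := j + m)) //=; last by lia.
  rewrite sum_shift per_sum //; lia.
have rec y : y <= j -> \sum_(y <= z < j) w z <= j - y.
  move=> yj; have lt : y < (2 * m).+1 by have := ltn_ord j; lia.
  have := jmin (Ordinal lt) isT; rewrite /H /=.
  rewrite [X in X + _ <= _](big_cat_nat (n := y)) //=; have := ltn_ord j; lia.
(* The record is the first nonzero letter from [j] on; the zeros skipped only lower the height. *)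
have exx : exists i, 0 < w (j + i).
  case: (boolP [exists i : 'I_m, 0 < w (j + i)]) => [/existsP[i ?]|]; first by exists i.
  rewrite negb_exists => /forallP Z; move: S0; rewrite -(per_sum j per).
  by rewrite big_mkord big1 // => i _; apply/eqP; rewrite -leqn0 leqNgt Z.
case: (ex_minnP exx) => i wi imin.
have zero z : j <= z -> z < j + i -> w z = 0.
  move=> jz zi; apply/eqP; rewrite -leqn0 leqNgt; apply/negP => wz.
  by have := imin (z - j); rewrite subnKC // wz; lia.
exists (j + i); split=> //; first by lia.
move=> y yx; have [yj|jy] := leqP y j.
  rewrite (big_cat_nat (n := j)) //= ?leq_addr // [X in _ + X]big1_seq; last first.
    by move=> z; rewrite mem_index_iota => h; apply: zero; lia.
  by have := rec y yj; lia.
rewrite big1_seq // => z; rewrite mem_index_iota => h; apply: zero; lia.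
Qed.

(* Induction on the sum of the word: erase an uncovered letter [x]; in the structure obtained,
   [x] is central, and [x] followed by the next central elements forms the missing block. *)
Lemma exists_offsets w : 0 < m -> (forall x, w (x + m) = w x) ->
  \sum_(0 <= z < m) w z < m -> exists2 o, nested m o & owidth m o =1 w.
Proof.
move=> m0; move: {2}(\sum_(0 <= z < m) w z).+1 (ltnSn (\sum_(0 <= z < m) w z)) => N.
elim: N w => // N IHN w leN per Sm.
have [S0|Spos] := posnP (\sum_(0 <= z < m) w z).
  exists (fun=> None); first by split=> // y z u /andP[].
  move=> y; rewrite owidthE big1 // -(per_mod y per); apply/esym/eqP.
  move/eqP: S0; rewrite sum_nat_seq_eq0 => /allP /(_ (y %% m)) /=.
  by rewrite mem_index_iota ltn_pmod // => /(_ isT).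
have [x [mx wx rec]] : exists x, [/\ m <= x, 0 < w x &
    forall y, y <= x -> \sum_(y <= z < x) w z <= x - y].
  by apply: exists_record => //; rewrite Spos.
pose w' z := if z == x %[mod m] then 0 else w z.
have per' z : w' (z + m) = w' z by rewrite /w' modnDr per.
have S' : \sum_(0 <= z < m) w' z + w x = \sum_(0 <= z < m) w z.
  have xm : x %% m \in index_iota 0 m by rewrite mem_index_iota ltn_pmod.
  rewrite !(bigD1_seq (x %% m)) ?iota_uniq //= /w' modn_mod eqxx per_mod // add0n addnC.
  congr addn; rewrite big_nat_cond [RHS]big_nat_cond; apply: eq_bigr => z /andP[/andP[_ zm]].
  by rewrite (modn_small zm) => /negbTE->.
have [o' no' Ew'] : exists2 o, nested m o & owidth m o =1 w'.
  by apply: IHN => //; lia.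
have [pero lto nest] := no'.
have Lo' := coarser_luk no' no' (coarser_refl no').
(* Were [x] covered, its arc of length [t + 1] would carry that much although the letter at [x] is
   erased, while [rec] allows only [t]. *)
have ox : o' x = None.
  case E: (o' x) => [t|] //; have tm := lto _ _ E.
  have ox : opens o' (x - t) x by rewrite /opens leq_subr E subKn ?eqxx //; lia.
  have := luk_arc no' Lo' ox; rewrite leqNgt => /negP[].
  rewrite big_nat_recr ?leq_subr //= Ew' /w' eqxx addn0.
  apply: (@leq_ltn_trans (\sum_(x - t <= z < x) w z)).
    by apply: leq_sum => z _; rewrite Ew' /w'; case: ifP.
  by have := rec (x - t) (leq_subr _ _); lia.
(* This is [z - x] modulo [m], with [x * m.-1] standing for [- x]. *)
pose d z := (z + x * m.-1) %% m.
have dx z : x + d z = z %[mod m].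
  rewrite /d modnDmr addnCA; have -> : x + x * m.-1 = x * m by rewrite -mulnS prednK.
  by rewrite addnC modnMDl.
have d_eq y z : y <= z -> d z = z - y -> y = x %[mod m].
  move=> yz dz; have := dx z; rewrite dz => E.
  have /eqP : x + (z - y) = y + (z - y) %[mod m] by rewrite (subnKC yz).
  by rewrite eqn_modDr => /eqP->.
have d_start y i : y = x %[mod m] -> i < m -> d (y + i) = i.
  move=> yx im; have := dx (y + i); rewrite -[RHS]modnDml yx modnDml => /eqP.
  by rewrite eqn_modDl /d modn_mod => /eqP ->; rewrite modn_small.
have d_lt z : d z < m by rewrite ltn_pmod.
have d_per z : d (z + m) = d z by rewrite /d addnAC modnDr.
(* The rank of a central element counted from [x]; the new block takes the ranks below [w x]. *)
pose rk r := \sum_(0 <= i < r) (o' (x + i) == None).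
pose o z := if (o' z == None) && (rk (d z) < w x) then Some (d z) else o' z.
have oE z t : o' z = Some t -> o z = Some t by rewrite /o => ->.
have ox' y : y = x %[mod m] -> o' y = None.
  by move=> yx; rewrite -(per_mod y pero) yx per_mod.
exists o.
  split=> [z|z t|y z u yz /andP[yu uz]].
  - by rewrite /o pero d_per.
  - by rewrite /o; case: ifP => _ => [[<-]|/lto].
  case: (boolP (opens o' y z)) => [oyz|noyz].
    have [|y' yy' oy'] := nest y z u oyz; first by rewrite yu.
    exists y' => //; case/andP: oy' => h /eqP/oE E; by rewrite /opens h E eqxx.
  have [new dz rkz] : [/\ o' z = None, d z = z - y & rk (d z) < w x].
    move: yz noyz; rewrite /opens; case/andP=> -> /=; rewrite /o.
    case: ifP => [/andP[/eqP oz rkz] /eqP[dz] _|_ ->] //.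
  have yz' := leq_trans yu uz; have yx := d_eq y z yz' dz.
  have du : d u = u - y by rewrite -{1}(subnKC yu) d_start //; have := d_lt z; lia.
  case E: (o' u) => [t|].
    (* Otherwise the old block of [u] passes over [y], which is central for [o'] because it is
       congruent to [x]. *)
    have tu : t <= u - y.
      rewrite leqNgt; apply/negP => ut; have tm := lto _ _ E.
      have ou : opens o' (u + m - t) (u + m).
        by rewrite /opens leq_subr pero E /=; apply/eqP; congr Some; lia.
      have [|a _] := nest _ _ (y + m) ou; first by lia.
      by rewrite /opens pero ox' // andbF.
    exists (u - t); first by lia.
    rewrite /opens leq_subr (oE _ _ E) /=; apply/eqP; congr Some; lia.
  exists y => //; rewrite /opens yu /o E du eqxx /=.
  have -> : rk (u - y) < w x; last by [].
  apply: leq_ltn_trans rkz; rewrite dz /rk [X in _ <= X](big_cat_nat (n := u - y)) //= ?leq_addr //.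
  by lia.
move=> y; rewrite owidthE; have [yx|nyx] := eqVneq (y %% m) (x %% m).
  rewrite -(per_mod y per) yx per_mod //.
  transitivity (\sum_(0 <= i < m) ((o' (x + i) == None) && (rk i < w x))).
    rewrite !big_nat; apply: eq_bigr => i /andP[_ im]; congr nat_of_bool.
    have -> : o' (x + i) = o' (y + i).
      by rewrite -(per_mod (x + i)) // -(per_mod (y + i)) // -modnDml -yx modnDml.
    rewrite /o d_start //; case: ifP => [_|_]; first by rewrite eqxx.
    apply/negbTE/negP => /eqP E.
    have : 0 < owidth m o' y.
      rewrite owidthE (bigD1_seq i) ?iota_uniq ?mem_index_iota //= E eqxx //.
    by rewrite Ew' /w' yx eqxx.
  (* There are enough central elements: their number is [m] minus the sum of [w'], and adding [w x]
     to that sum stays below [m]. *)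
  rewrite count_first; apply/minn_idPl.
  have := owidth_total no'; rewrite (eq_bigr _ (fun y _ => Ew' y)).
  rewrite (per_sum (F := fun z => o' z == None : nat) x) => [|z]; first by lia.
  by rewrite pero.
have -> : w y = w' y by rewrite /w' (negbTE nyx).
rewrite -Ew' owidthE; apply: eq_bigr => i _; rewrite /o; case: ifP => // /andP[/eqP-> _].
case: eqP => // -[E]; have := d_eq y (y + i); rewrite leq_addr addKn => /(_ isT E) yx.
by rewrite yx eqxx in nyx.
Qed.

End Existence.

(** * Summing over the refinements of a fixed structure *)

Lemma wsum_tuple M n f : wsum M n f = \sum_(t : n.-tuple 'I_M) f (map val t).
Proof.
elim: n f => [|n IHn] f /=.
  by rewrite (bigD1 [tuple]) //= big1 ?addn0 // => t; rewrite tuple0.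
rewrite (eq_bigr _ (fun x _ => IHn _)) pair_big /=.
rewrite (reindex (fun p : 'I_M * n.-tuple 'I_M => cons_tuple p.1 p.2)) //=.
exists (fun t => (thead t, behead_tuple t)) => [[x t] _|t _] /=.
  by congr pair; apply: val_inj.
by rewrite [RHS]tuple_eta; apply: val_inj.
Qed.

(** The height is [h] plus the letters read minus their number. This turns the recursive test into
    the partial sum conditions of [lukasiewicz], along the positions selected by [p]. *)
Lemma luk_filter (W : nat -> nat) (p : pred nat) h a r :
  luk h [seq W z | z <- iota a r & p z] <->
  (forall q, q <= a + r -> \sum_(a <= z < q | p z) 1 <= h + \sum_(a <= z < q | p z) W z)
  /\ h + \sum_(a <= z < a + r | p z) W z = \sum_(a <= z < a + r | p z) 1.
Proof.
elim: r h a => [|r IHr] h a /=.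
  rewrite addn0 !big_geq // addn0; split=> [/eqP->|[_ ->] //].
  by split=> // q qa; rewrite big_geq.
have step (F : nat -> nat) q : a < q ->
    \sum_(a <= z < q | p z) F z = (if p a then F a else 0) + \sum_(a.+1 <= z < q | p z) F z.
  by move=> aq; rewrite big_mkcond big_ltn //= -big_mkcond.
rewrite addnS -addSn !step ?ltn_addr //; case: ifP => pa /=; last first.
  rewrite IHr !add0n; split=> -[h1 h2]; split=> // q ha.
    have [qa|aq] := leqP q a; first by rewrite big_geq.
    by rewrite !step // pa !add0n; apply: h1.
  have [qa|aq] := leqP q a; first by rewrite big_geq // ltnW.
  by have := h1 q ha; rewrite !step // pa.
split=> [/andP[h0 /IHr[h1 h2]]|[h1 h2]].
  split=> [q ha|]; last by lia.
  have [qa|aq] := leqP q a; first by rewrite big_geq.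
  by have := h1 q ha; rewrite !step // pa; lia.
have h0 : 0 < h + W a.
  by have := h1 a.+1; rewrite !step // pa !big_geq //; lia.
rewrite h0; apply/IHr; split=> [q ha|]; last by lia.
have [qa|aq] := leqP q a; first by rewrite big_geq // ltnW.
by have := h1 q ha; rewrite !step // pa; lia.
Qed.

Lemma seg_flatten (bl : seq (seq nat)) zs :
  seg (map size bl) (flatten bl ++ zs) = all (luk 0) bl && (sumn zs < size zs).
Proof.
elim: bl => //= b bl IH.
by rewrite -catA take_size_cat // drop_size_cat // IH andbA.
Qed.

Lemma map_nth_index (T : eqType) (U : Type) (x0 : U) (s : seq T) (w : seq U) :
  uniq s -> size w = size s -> [seq nth x0 w (index z s) | z <- s] = w.
Proof.
case: s => [|z0 s] us sw; first by case: w sw.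
apply: (@eq_from_nth _ x0) => [|i]; rewrite size_map // => lti.
by rewrite (nth_map z0) // index_uniq.
Qed.

(** * Words read block by block *)

Section BlockWords.
Variable m : nat.
Implicit Types (o : nat -> option nat) (W : nat -> nat).

Definition block_offsets o y := [seq i <- iota 0 m | o (y + i) == Some i].

Lemma luk_blocks o W : nested m o ->
  lukasiewicz m o W <-> forall y, luk 0 [seq W (y + i) | i <- block_offsets o y].
Proof.
move=> no.
have shift (F : nat -> nat) y r : \sum_(y <= z < y + r | opens o y z) F z =
    \sum_(0 <= i < r | o (y + i) == Some i) F (y + i).
  rewrite big_mkcond sum_shift -big_mkcond; apply: eq_bigl => i.
  by rewrite /opens leq_addr addKn.
split=> [[L1 L2] y|L].
  apply/(luk_filter (fun i => W (y + i)) (fun i => o (y + i) == Some i) 0 0 m).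
  split=> [q _|]; last by rewrite add0n -(shift W) -(shift (fun=> 1)) L2.
  by rewrite add0n -(shift W) -(shift (fun=> 1)).
have L' y := proj1 (luk_filter (fun i => W (y + i)) (fun i => o (y + i) == Some i) 0 0 m) (L y).
split=> y; last by have [_] := L' y; rewrite !add0n -(shift W) -(shift (fun=> 1)).
move=> q; have [qy|yq] := leqP q y; first by rewrite big_geq.
have E (F : nat -> nat) : \sum_(y <= z < q | opens o y z) F z =
    \sum_(y <= z < y + minn (q - y) m | opens o y z) F z.
  by apply: sum_opens_ext => z yz /(opens_lt no); lia.
rewrite !E (shift W) (shift (fun=> 1)).
by have [L1 _] := L' y; apply: L1; rewrite geq_minr.
Qed.

Lemma size_block_offsets o y : size (block_offsets o y) = owidth m o y.
Proof. by rewrite owidthE size_filter -sum1_count big_mkcond /index_iota subn0. Qed.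

Definition block_of o y := [seq (y + i) %% m | i <- block_offsets o y].

Definition block_order o ops :=
  flatten [seq block_of o y | y <- ops] ++ [seq z <- iota 0 m | o z == None].

(** Every residue occurs, in its block or among the central ones, and the length is [m] by
    [owidth_total]; so nothing is repeated. *)
Lemma block_order_perm o ops : 0 < m -> nested m o ->
  perm_eq ops [seq y <- iota 0 m | 0 < owidth m o y] ->
  perm_eq (block_order o ops) (iota 0 m).
Proof.
move=> m0 no opsP; have [per lt _] := no.
have szS : size (block_order o ops) = m.
  rewrite size_cat size_flatten /shape -map_comp.
  rewrite (eq_map (g := owidth m o)); last by move=> y; rewrite /= size_map size_block_offsets.
  rewrite sumnE big_map (perm_big _ opsP) big_filter /= -[RHS](owidth_total no) size_filter.
  rewrite -sum1_count /index_iota !subn0; congr addn; last by rewrite big_mkcond.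
  by rewrite big_mkcond; apply: eq_bigr => y _; case: posnP.
have subS : {subset iota 0 m <= block_order o ops}.
  move=> z; rewrite mem_iota mem_cat => zm; case E: (o z) => [t|]; last first.
    by rewrite mem_filter E eqxx mem_iota zm orbT.
  have tm := lt _ _ E; apply/orP; left; apply/flattenP.
  have Et : o ((z + m - t) %% m + t) = Some t.
    rewrite -(per_mod _ per) modnDml subnK; last by lia.
    by rewrite per_mod // per.
  exists (block_of o ((z + m - t) %% m)).
    apply: map_f; rewrite (perm_mem opsP) mem_filter mem_iota ltn_pmod // andbT.
    rewrite owidthE (bigD1_seq t) ?iota_uniq ?mem_index_iota //=.
    by rewrite Et eqxx.
  apply/mapP; exists t; first by rewrite mem_filter mem_iota Et eqxx.
  by rewrite modnDml subnK ?modnDr ?modn_small //; lia.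
have uS : uniq (block_order o ops).
  by apply: leq_size_uniq subS _; rewrite ?iota_uniq // size_iota szS.
apply: uniq_perm uS (iota_uniq _ _) _ => x.
have [|_ E] := uniq_min_size (iota_uniq 0 m) subS; first by rewrite size_iota szS.
by rewrite E.
Qed.

(** Along noncentral blocks a Lukasiewicz word sums to its length, so a total below [m] amounts to
    the strict inequality on the central remainder. *)
Lemma seg_block_order o ops W : 0 < m -> nested m o ->
  (forall x, W (x + m) = W x) ->
  perm_eq ops [seq y <- iota 0 m | 0 < owidth m o y] ->
  seg (map (owidth m o) ops) (map W (block_order o ops)) <->
  lukasiewicz m o W /\ \sum_(0 <= z < m) W z < m.
Proof.
move=> m0 no perW opsP; have [per lt _] := no.
pose zs := [seq z <- iota 0 m | o z == None].
have -> : map (owidth m o) ops = map size [seq map W (block_of o y) | y <- ops].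
  by rewrite -map_comp; apply: eq_map => y /=; rewrite !size_map size_block_offsets.
have -> : map W (block_order o ops) = flatten [seq map W (block_of o y) | y <- ops] ++ map W zs.
  by rewrite map_cat map_flatten -map_comp.
rewrite seg_flatten size_map.
have blkW y : map W (block_of o y) = [seq W (y + i) | i <- block_offsets o y].
  by rewrite -map_comp; apply: eq_map => i /=; rewrite per_mod.
have allL : all (luk 0) [seq map W (block_of o y) | y <- ops] <-> lukasiewicz m o W.
  rewrite luk_blocks //; split=> [/allP h y|h]; last first.
    by apply/allP => b /mapP[y _ ->]; rewrite blkW.
  have E : [seq W (y + i) | i <- block_offsets o y] = [seq W (y %% m + i) | i <- block_offsets o (y %% m)].
    have -> : block_offsets o (y %% m) = block_offsets o y.
      by apply: eq_filter => i; rewrite per_modDl.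
    by apply: eq_map => i; rewrite per_modDl.
  rewrite E; have [S0|Spos] := posnP (owidth m o (y %% m)).
    by have := S0; rewrite -size_block_offsets => /size0nil->.
  rewrite -blkW; apply: h; apply: map_f.
  by rewrite (perm_mem opsP) mem_filter Spos mem_iota ltn_pmod.
have tot : lukasiewicz m o W -> \sum_(0 <= z < m) W z =
    \sum_(0 <= y < m) owidth m o y + sumn (map W zs).
  move=> L; have -> : \sum_(0 <= z < m) W z = sumn (map W (block_order o ops)).
    rewrite sumnE big_map (perm_big _ (block_order_perm m0 no opsP)) /index_iota subn0 //.
  rewrite map_cat sumn_cat; congr addn.
  rewrite map_flatten -map_comp sumn_flatten -map_comp sumnE big_map.
  rewrite (perm_big _ opsP) big_filter big_mkcond /index_iota subn0; apply: eq_bigr => y _ /=.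
  rewrite -size_block_offsets; have [S0|Spos] := posnP; first by [].
  rewrite blkW; have /luk_blocks := L; move=> /(_ no y).
  move/(luk_filter (fun i => W (y + i)) (fun i => o (y + i) == Some i) 0 0 m) => [_].
  rewrite !add0n sumnE big_map big_filter /index_iota !subn0 => ->.
  by rewrite size_filter sum1_count.
have zsz : size zs = \sum_(0 <= z < m) (o z == None).
  by rewrite size_filter -sum1_count big_mkcond /index_iota subn0.
have Em := owidth_total no; rewrite -zsz in Em.
split=> [/andP[/allL L lt']|[L lt']].
  by split=> //; rewrite tot //; lia.
apply/andP; split; first exact/allL.
by move: lt'; rewrite tot //; lia.
Qed.

End BlockWords.

(** * Finite encoding of periodic structures and the count of refinements *)

Section Model.
Variable m : nat.
Hypothesis m0 : 0 < m.

Definition model := {ffun 'I_m -> option 'I_m}.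
Implicit Types (e : model).

Definition off e x : option nat := omap val (e (Ordinal (ltn_pmod x m0))).

Lemma off_per e x : off e (x + m) = off e x.
Proof. by congr (omap val (e _)); apply: val_inj; rewrite /= modnDr. Qed.

Lemma off_lt e x t : off e x = Some t -> t < m.
Proof. by rewrite /off; case: (e _) => //= i [<-]. Qed.

(** Two periods suffice: after a translation [y] lies in the first one and its block ends before
    [y + m]. *)
Definition nestedb e :=
  [forall y : 'I_(2 * m), forall z : 'I_(2 * m), forall u : 'I_(2 * m),
    opens (off e) y z && (y <= u <= z) ==>
    [exists y' : 'I_(2 * m), (y <= y') && opens (off e) y' u]].

Lemma nestedP e : reflect (nested m (off e)) (nestedb e).
Proof.
have per := off_per e; apply: (iffP idP) => [h|[_ _ nest]]; last first.
  apply/forallP => y; apply/forallP => z; apply/forallP => u; apply/implyP => /andP[yz yu].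
  have [y' h1 h2] := nest _ _ _ yz yu; apply/existsP.
  have lt : y' < 2 * m by apply: leq_ltn_trans (ltn_ord u); apply: opens_le h2.
  by exists (Ordinal lt); rewrite h1.
split=> [//|x t|y z u yz /andP[yu uz]]; first exact: off_lt.
pose c := y %/ m; have yc := divn_eq y m; rewrite -/c in yc.
have shift a b : c * m <= a -> c * m <= b ->
    opens (off e) (a - c * m) (b - c * m) = opens (off e) a b.
  move=> ca cb; rewrite /opens -(per_mul (b - c * m) c per) subnK //.
  by congr andb; [lia|congr (_ == Some _); lia].
have zy : z < y + m.
  by have := yz; rewrite /opens => /andP[? /eqP/off_lt]; lia.
have ym : y %% m < m by rewrite ltn_pmod.
have lty : y - c * m < 2 * m by lia.
have ltz : z - c * m < 2 * m by lia.
have ltu : u - c * m < 2 * m by lia.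
have := h => /forallP/(_ (Ordinal lty))/forallP/(_ (Ordinal ltz))/forallP/(_ (Ordinal ltu)).
rewrite /= shift ?yz; [|lia|lia].
have -> : y - c * m <= u - c * m <= z - c * m by lia.
case/existsP => y' /andP[h1 h2]; exists (y' + c * m); first by lia.
rewrite -shift ?leq_addl ?addnK //; lia.
Qed.

Definition centered e := nestedb e && [exists x, e x == None].

Definition widths e := [seq owidth m (off e) y | y <- iota 0 m].
Definition sizes e := letters (widths e).

Lemma off_ord e (x : 'I_m) : off e x = omap val (e x).
Proof. by congr (omap val (e _)); apply: val_inj; rewrite /= modn_small. Qed.

Lemma off_inj e1 e2 : off e1 =1 off e2 -> e1 = e2.
Proof.
move=> E; apply/ffunP => x; have := E x; rewrite !off_ord.
by case: (e1 x) (e2 x) => [i|] [j|] //= [] /val_inj->.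
Qed.

Lemma off_exists o : nested m o -> exists e, off e =1 o.
Proof.
case=> per lt _; exists [ffun x : 'I_m => obind insub (o x)] => x.
rewrite /off ffunE /= per_mod //; case E: (o x) => [t|] //=.
by rewrite insubT /= ?(lt _ _ E).
Qed.

Lemma centered_sum e : nestedb e ->
  centered e = (\sum_(0 <= z < m) owidth m (off e) z < m).
Proof.
move=> ne; rewrite /centered ne /=; have /nestedP/owidth_total := ne.
case: (boolP [exists x, e x == None]) => [/existsP[x /eqP ex]|].
  rewrite [X in _ + X](bigD1_seq (x : nat)) ?iota_uniq ?mem_index_iota //=.
  by rewrite off_ord ex /=; lia.
rewrite negb_exists => /forallP Z; rewrite [X in _ + X]big1_seq ?addn0 => [->|z].
  by rewrite ltnn.
rewrite mem_index_iota => zm; have := Z (Ordinal zm).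
by have /= -> := off_ord e (Ordinal zm); case: (e _).
Qed.

Lemma sumn_widths e : sumn (widths e) = \sum_(0 <= z < m) owidth m (off e) z.
Proof. by rewrite sumnE big_map /index_iota subn0. Qed.

Lemma sumn_letters w : sumn (letters w) = sumn w.
Proof. by elim: w => //= -[|x] w /= ->. Qed.

Lemma opens_eq_off e1 e2 : (forall a x, opens (off e1) a x = opens (off e2) a x) ->
  off e1 =1 off e2.
Proof.
move=> E x; rewrite -(off_per e1) -(off_per e2).
have sub f g : (forall a x, opens (off f) a x = opens (off g) a x) ->
    forall t, off f (x + m) = Some t -> off g (x + m) = Some t.
  move=> Efg t Et; have tm := off_lt Et.
  have := Efg (x + m - t) (x + m); rewrite /opens leq_subr Et subKn ?eqxx /=; last by lia.
  by move/esym/eqP.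
case E1: (off e1 (x + m)) => [t|]; first by rewrite (sub _ _ E _ E1).
by case E2: (off e2 (x + m)) => [t|//]; rewrite (sub e2 e1 (fun a x => esym (E a x)) _ E2) in E1.
Qed.

Lemma widths_inj e1 e2 : nestedb e1 -> nestedb e2 -> widths e1 = widths e2 -> e1 = e2.
Proof.
move=> /nestedP n1 /nestedP n2 E; apply/off_inj/opens_eq_off/(owidth_inj n1 n2) => y.
have per f z : owidth m (off f) (z + m) = owidth m (off f) z by apply/owidth_per/off_per.
rewrite -(per_mod y (per e1)) -(per_mod y (per e2)).
have ym : y %% m < m by rewrite ltn_pmod.
have := congr1 (fun s => nth 0 s (y %% m)) E.
by rewrite /widths !(nth_map 0) ?size_iota // !nth_iota.
Qed.

(** For the sizes [s] of a centered structure this is a sum over its refinements, by [sum_finer]. It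
    is defined for every [s] so as to be summed over all sequences. *)
Definition finer_sum q (f : seq nat -> nat) (s : seq nat) :=
  wsum m m (fun w => seg s w * bweight q f w).

Lemma perm_map_lift (T : eqType) (s : seq nat) (g : T -> nat) (r : seq T) :
  perm_eq s (map g r) -> exists2 r', perm_eq r' r & s = map g r'.
Proof.
case: r => [|x0 r] P; first by exists [::] => //; apply/eqP; rewrite -size_eq0 (perm_size P).
have /(perm_iotaP 0)[I PI ->] := P; exists [seq nth x0 (x0 :: r) i | i <- I].
  apply/(perm_iotaP x0); exists I => //; by rewrite size_map in PI.
rewrite -map_comp; apply/eq_in_map => i; rewrite (perm_mem PI) mem_iota size_map => Hi.
by rewrite (nth_map x0).
Qed.

(** Widths read in the order of [block_order] give a bijection between refinements of [e] and words
    accepted by [seg s]: injective by [widths_inj], onto by [exists_offsets]. The order of [s]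
    dictates that of the blocks, so the letters form some permutation of [sizes e1]; hence the
    hypothesis on [F] and [f] for all permutations. *)
Lemma sum_finer (P : pred model) (F : model -> nat) f e q s :
  centered e -> (forall e1, centered e1 -> P e1 <-> coarser (off e1) (off e)) ->
  (forall e1 s1, centered e1 -> perm_eq s1 (sizes e1) -> F e1 = f s1) ->
  perm_eq s (sizes e) ->
  \sum_(e1 | [&& centered e1, P e1 & size (sizes e1) == q]) F e1 = finer_sum q f s.
Proof.
move=> ge HP Ff ps; have ne := andP ge; case: ne => neb _; have /nestedP ne := neb.
have sizesE : sizes e = map (owidth m (off e)) [seq y <- iota 0 m | 0 < owidth m (off e) y].
  by rewrite /sizes /letters /widths filter_map.
rewrite sizesE in ps; have [ops opsP Es] := perm_map_lift ps.
pose S := block_order m (off e) ops.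
have SP := block_order_perm m0 ne opsP; rewrite -/S in SP.
have uS : uniq S by rewrite (perm_uniq SP) iota_uniq.
have szS : size S = m by rewrite (perm_size SP) size_iota.
have Sm z : (z \in S) = (z < m) by rewrite (perm_mem SP) mem_iota.
pose word e1 : seq nat := map (owidth m (off e1)) S.
have wper e1 z : owidth m (off e1) (z + m) = owidth m (off e1) z by apply/owidth_per/off_per.
have word_widths e1 : perm_eq (word e1) (widths e1) by apply: perm_map.
have word_sizes e1 : perm_eq (letters (word e1)) (sizes e1) by apply: perm_filter.
have word_inj e1 e2 : nestedb e1 -> nestedb e2 -> word e1 = word e2 -> e1 = e2.
  move=> n1 n2 /eq_in_map E; apply: widths_inj => //; apply/eq_in_map => z.
  by rewrite mem_iota => zm; apply: E; rewrite Sm.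
(* The reduction modulo [m] casts letters into ['I_m]; the widths of a centered structure are below
   [m] and survive it. *)
pose enc e1 : m.-tuple 'I_m :=
  [tuple of mkseq (fun i => Ordinal (ltn_pmod (nth 0 (word e1) i) m0)) m].
have encE e1 : centered e1 -> map val (enc e1) = word e1.
  move=> g1; have n1 : nestedb e1 by case/andP: g1.
  apply: (@eq_from_nth _ 0) => [|i]; rewrite !size_map ?size_iota ?szS // => im.
  rewrite -map_comp (nth_map 0) ?size_iota // nth_iota //= modn_small //.
  rewrite (nth_map 0) ?szS //; set z := nth 0 S i.
  have zm : z < m by rewrite -Sm mem_nth ?szS.
  move: g1; rewrite centered_sum //; apply: leq_ltn_trans.
  by rewrite (bigD1_seq z (r := index_iota 0 m)) ?iota_uniq ?mem_index_iota //= leq_addr.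
have segE e1 : centered e1 -> seg s (word e1) = P e1.
  move=> g1; have n1 : nestedb e1 by case/andP: g1.
  have /nestedP n1' := n1; apply/idP/idP.
    by rewrite Es => /(seg_block_order m0 ne (wper e1) opsP)[L _]; apply/HP => //; exact: luk_coarser L.
  move/(HP _ g1) => c; rewrite Es; apply/(seg_block_order m0 ne (wper e1) opsP).
  by split; [exact: coarser_luk|rewrite -centered_sum].
have decode (w : seq nat) : size w = m -> seg s w -> exists2 e1, centered e1 & word e1 = w.
  move=> sw sg; pose W z := nth 0 w (index (z %% m) S).
  have WS : map W S = w.
    rewrite -[RHS](map_nth_index 0 uS) ?szS //; apply/eq_in_map => z.
    by rewrite Sm /W => zm; rewrite modn_small.
  have perW x : W (x + m) = W x by rewrite /W modnDr.
  move: sg; rewrite Es -WS => /(seg_block_order m0 ne perW opsP)[L lt].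
  have [o no Eo] := exists_offsets m0 perW lt.
  have [e1 E1] := off_exists no.
  have ow1 y : owidth m (off e1) y = W y.
    by rewrite -Eo !owidthE; apply: eq_bigr => i _; rewrite E1.
  have n1 : nestedb e1.
    apply/nestedP; split; [exact: off_per|exact: off_lt|move=> y z u].
    rewrite /opens E1 => h1 h2; have [_ _ /(_ y z u h1 h2)[y' ? ?]] := no.
    by exists y' => //; rewrite /opens E1.
  exists e1; last by apply: eq_map.
  by rewrite centered_sum // (eq_bigr _ (fun y _ => ow1 y)).
rewrite /finer_sum wsum_tuple.
pose dec (t : m.-tuple 'I_m) := odflt e [pick e1 | centered e1 && (enc e1 == t)].
have decK (t : m.-tuple 'I_m) : seg s (map val t) -> centered (dec t) /\ enc (dec t) = t.
  move=> sg; rewrite /dec; case: pickP => [e1 /andP[? /eqP?] //|/=].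
  have [|e1 g1 E1] := decode _ _ sg; first by rewrite size_map size_tuple.
  move/(_ e1); rewrite g1 => /eqP[]; apply/val_inj/(inj_map val_inj).
  by rewrite encE.
rewrite [RHS](_ : _ = \sum_(t : m.-tuple 'I_m | seg s (map val t) &&
    (size (letters (map val t)) == q)) f (letters (map val t))); last first.
  rewrite [RHS]big_mkcond; apply: eq_bigr => t _; rewrite /bweight.
  by case: (seg _ _); case: (_ == q); rewrite ?mul0n ?mul1n.
rewrite (reindex_onto enc dec) /=; last by move=> t /andP[/decK[]].
apply: eq_big => [e1|e1 /and3P[g1 _ _]]; last first.
  by apply: Ff => //; rewrite encE.
have sz : centered e1 -> size (letters (map val (enc e1))) = size (sizes e1).
  by move=> g1; rewrite encE // (perm_size (word_sizes e1)).
apply/idP/idP.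
  case/and3P => g1 p1 q1; rewrite encE // segE // p1 -encE // sz // q1 /=.
  have sg : seg s (map val (enc e1)) by rewrite encE // segE.
  have [g2 E2] := decK _ sg; apply/eqP; apply: word_inj.
  - by case/andP: g2.
  - by case/andP: g1.
  by rewrite -!encE // E2.
case/andP => /andP[sg sq] /eqP E; have [g1 _] := decK _ sg; rewrite E in g1.
by rewrite g1 -segE // -sz // -encE // sg sq.
Qed.

End Model.

(** * Lifting partitions to the integers *)

Section Lifts.
Variable m : nat.
Hypothesis m0 : 0 < m.
Implicit Types (o : nat -> option nat).

(* The first element, modulo [2m], of the block of [x] in the circular picture. *)
Definition okey o x : option nat :=
  omap (fun t => (x + 2 * m - t) %% (2 * m)) (o x).

Lemma okey_opens o a x : opens o a x -> okey o x = Some (a %% (2 * m)).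
Proof.
case/andP=> ax /eqP E; rewrite /okey E /=; congr Some.
by rewrite -(modnDr a); congr modn; lia.
Qed.

Lemma okey_some o x b : nested m o -> m <= x -> okey o x = Some b ->
  exists2 a, opens o a x & a %% (2 * m) = b.
Proof.
move=> [_ lt _] mx; rewrite /okey; case E: (o x) => [t|] //= [<-].
have tm := lt _ _ E; exists (x - t); first by rewrite /opens leq_subr E subKn ?eqxx //; lia.
by rewrite -(modnDr (x - t)); congr modn; lia.
Qed.

Lemma okey_per o x : nested m o -> okey o (x + 2 * m) = okey o x.
Proof.
move=> [per lt _]; rewrite /okey (per_mul x 2 per).
case E: (o x) => [t|] //=; have := lt _ _ E => tm; congr Some.
by rewrite -(modnDr (x + _ - t)); congr modn; lia.
Qed.

Lemma okey_none o x : (okey o x == None) = (o x == None).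
Proof. by rewrite /okey; case: (o x). Qed.

Lemma okey_mod o x y : nested m o -> x = y %[mod 2 * m] -> okey o x = okey o y.
Proof.
move=> no E; have per z := okey_per z no.
by rewrite -(per_mod (m := 2 * m) x per) E per_mod.
Qed.

Lemma mod_window c a b : a = b %[mod c] -> a <= b < a + c -> a = b.
Proof.
move=> E /andP[ab lt]; move/esym/eqP: E; rewrite eqn_mod_dvd // => d.
have [|p] := posnP (b - a); first by lia.
by have := gtnNdvd p (_ : b - a < c); rewrite d => /(_ _); lia.
Qed.

Lemma mod_window2 c a b : 0 < c -> a = b %[mod c] -> a < b + c -> b < a + 2 * c ->
  b = a \/ b = a + c.
Proof.
move=> c0 E h1 h2; have [ba|ab] := ltnP b a.
  by left; apply: (mod_window (c := c)); [rewrite E|lia].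
have [lt|ge] := ltnP b (a + c); [left|right]; apply/esym/(mod_window (c := c)) => //; try lia.
by rewrite modnDr.
Qed.

(** Keys know openers modulo [2 * m] only; within a window of one turn, equal keys mean openers
    equal or one turn apart. *)
Lemma okey_two o x y b : nested m o -> m <= x -> x <= y < x + 2 * m ->
  okey o x = Some b -> okey o y = Some b ->
  exists p p', [/\ opens o p x, opens o p' y & p' = p \/ p' = p + 2 * m].
Proof.
move=> no mx /andP[xy yx] kx ky.
have [p px pb] := okey_some no mx kx.
have [p' py pb'] := okey_some no (leq_trans mx xy) ky.
exists p, p'; split=> //; apply: mod_window2; rewrite ?pb ?pb' //; first by lia.
- by have := opens_le px; have := opens_lt no py; lia.
- by have := opens_le py; have := opens_lt no px; lia.
Qed.

Lemma opens_between o p z q u : nested m o -> opens o p z -> opens o q u -> p <= u <= z ->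
  p <= q.
Proof.
move=> [_ _ nest] pz qu h; have [q' pq' qu'] := nest _ _ _ pz h.
by rewrite (opens_inj qu qu').
Qed.

Lemma opens_covered o p z u : nested m o -> opens o p z -> p <= u <= z -> okey o u <> None.
Proof.
move=> [_ _ nest] pz h; have [q' _ qu'] := nest _ _ _ pz h.
by rewrite (okey_opens qu').
Qed.

Lemma opens_shift2 o a x : nested m o -> opens o (a + 2 * m) (x + 2 * m) = opens o a x.
Proof. exact: opens_add. Qed.

(** Each pair has one lifted opener or two that are a turn apart; in all four cases nesting bounds
    the openers by each other. If just one of the blocks were central, one of its elements would lie
    under an arc of the other. *)
Lemma okey_noncrossing o a b c d : nested m o -> m <= a -> a < b -> b < c -> c < d ->
  d < a + 2 * m -> okey o a = okey o c -> okey o b = okey o d -> okey o a = okey o b.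
Proof.
move=> no ma ab bc cd da ac bd.
have covR p q : opens o p b -> opens o q d -> q = p \/ q = p + 2 * m -> okey o a <> None.
  move=> pb qd [Eq|Eq].
    rewrite ac; apply: opens_covered qd _ => //; first by rewrite Eq; have := opens_le pb; lia.
  rewrite -(okey_per a no); apply: (@opens_covered _ q (b + 2 * m)) => //.
    by rewrite Eq opens_shift2.
  by have := opens_le qd; lia.
have covL p q : opens o p a -> opens o q c -> q = p \/ q = p + 2 * m -> okey o b <> None.
  move=> pa qc [Eq|Eq].
    apply: opens_covered qc _ => //; by rewrite Eq; have := opens_le pa; lia.
  rewrite bd; apply: (@opens_covered _ q (a + 2 * m)) => //.
    by rewrite Eq opens_shift2.
  by have := opens_le qc; lia.
case Ea: (okey o a) => [ka|]; case Eb: (okey o b) => [kb|] //.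
- have [||p [p' [pa pc Ep]]] := okey_two no _ _ Ea (etrans (esym ac) Ea); [lia|lia|].
  have [||q [q' [qb qd Eq]]] := okey_two no _ _ Eb (etrans (esym bd) Eb); [lia|lia|].
  have pa' : opens o (p + 2 * m) (a + 2 * m) by rewrite opens_shift2.
  have qb' : opens o (q + 2 * m) (b + 2 * m) by rewrite opens_shift2.
  have := opens_le pa; have := opens_le pc; have := opens_le qb; have := opens_le qd.
  move=> h1 h2 h3 h4.
  suff Epq : p = q %[mod 2 * m].
    by rewrite -Ea -Eb (okey_opens pa) (okey_opens qb) Epq.
  case: Ep => Ep; case: Eq => Eq.
  + have i1 := opens_between no pc qb; have i2 := opens_between no qd pc.
    by congr modn; lia.
  + have i1 := opens_between no pc qb; have i2 := opens_between no qb' pa'.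
    by congr modn; lia.
  + have i1 := opens_between no pa' qd; have i2 := opens_between no qd pc.
    by rewrite -[LHS]modnDr; congr modn; lia.
  + have i1 := opens_between no pa' qd; have i2 := opens_between no qb' pa'.
    by congr modn; lia.
- have [||p [p' [pa pc Ep]]] := okey_two no _ _ Ea (etrans (esym ac) Ea); [lia|lia|].
  by case: (covL _ _ pa pc Ep).
- have [||q [q' [qb qd Eq]]] := okey_two no _ _ Eb (etrans (esym bd) Eb); [lia|lia|].
  by case: (covR _ _ qb qd Eq).
Qed.

Lemma okey_coarser o1 o2 : nested m o1 -> nested m o2 ->
  (forall x y, okey o1 x = okey o1 y -> okey o2 x = okey o2 y) <-> coarser o1 o2.
Proof.
move=> n1 n2; split=> [K|[c1 c2] x y].
  have c1 a x : opens o1 a x -> forall b, opens o2 b a = opens o2 b x.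
    move=> ax b; have := opens_le ax; have := opens_lt n1 ax => xa ax'.
    have E : okey o2 (a + 2 * m) = okey o2 (x + 2 * m).
      by rewrite !okey_per //; apply: K; rewrite (okey_opens ax) (okey_opens (opens_self n1 ax)).
    case Ea: (okey o2 (a + 2 * m)) => [k|]; last first.
      rewrite !okey_per // in Ea E; rewrite Ea in E.
      by apply/idP/idP => /okey_opens; [rewrite Ea|rewrite -E].
    have [||p [p' [pa px Ep]]] := okey_two n2 _ _ Ea (etrans (esym E) Ea); [lia|lia|].
    have Ep' : p' = p.
      by case: Ep => // ?; have := opens_lt n2 pa; have := opens_le px; lia.
    rewrite Ep' in px; rewrite -(opens_shift2 b a) // -(opens_shift2 b x) //.
    by apply/idP/idP => h; [rewrite (opens_inj h pa)|rewrite (opens_inj h px)].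
  split=> // b x bx; have bx2 : opens o2 (b + 2 * m) (x + 2 * m) by rewrite opens_shift2.
  case E: (okey o1 (x + 2 * m)) => [k|]; last first.
    (* The central block of [o1] contains both [x] and [x + m], but their openers in [o2] differ by
       [m], which is not 0 modulo [2 * m]. *)
    have E1 : okey o1 x = None by rewrite -okey_per.
    have E2 : okey o1 (x + m) = None.
      by have [per _ _] := n1; move/eqP: E1; rewrite okey_none => /eqP; rewrite /okey per => ->.
    have := K x (x + m); rewrite E1 E2 (okey_opens bx) => /(_ erefl).
    have bxm : opens o2 (b + m) (x + m) by rewrite -(opens_add b x 1 n2) mul1n in bx.
    rewrite (okey_opens bxm) => -[/esym/eqP]; rewrite -[X in _ == X %[mod _]]addn0 eqn_modDl.
    by rewrite mod0n modn_small; lia.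
  have [|a ax _] := okey_some n1 _ E; first by lia.
  have := opens_le bx2; rewrite -(c1 _ _ ax) in bx2; have ba := opens_le bx2 => _.
  exists (a - 2 * m); rewrite -opens_shift2 // subnK //; lia.
have rep z : okey o1 (z + 2 * m) <> None ->
    exists a, [/\ 2 * m <= a + m, okey o1 z = Some (a %% (2 * m)) & okey o2 z = okey o2 a].
  case E: (okey o1 (z + 2 * m)) => [k|] // _.
  have [|a az Ek] := okey_some n1 _ E; first by lia.
  have := opens_lt n1 az => za.
  exists a; split; [lia|by rewrite -okey_per // E Ek|].
  rewrite -okey_per //; case E2: (okey o2 (z + 2 * m)) => [j|].
    have [|b bz <-] := okey_some n2 _ E2; first by lia.
    by rewrite -(c1 _ _ az) in bz; rewrite (okey_opens bz).
  case E3: (okey o2 a) => [j|] //.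
  have [|b ba _] := okey_some n2 _ E3; first by lia.
  by rewrite (c1 _ _ az) in ba; rewrite (okey_opens ba) in E2.
have none z : okey o1 z = None -> okey o2 z = None.
  move=> E; case E2: (okey o2 z) => [j|] //; rewrite -okey_per // in E2.
  have [|b bz _] := okey_some n2 _ E2; first by lia.
  by have [a /okey_opens] := c2 _ _ bz; rewrite okey_per // E.
move=> E; case Ex: (okey o1 x) => [k|]; last by rewrite !none // -E.
have [|a [ma Ea ->]] := rep x; first by rewrite okey_per // Ex.
have [|b [mb Eb ->]] := rep y; first by rewrite okey_per // -E Ex.
by apply: okey_mod => //; rewrite Ea Eb in E; case: E.
Qed.

(* [R] is the relation of lying in the same block, lifted from the [2m]-gon. *)
Section Encode.
Variable R : rel nat.
Hypothesis Rrefl : reflexive R.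
Hypothesis Rsym : symmetric R.
Hypothesis Rtrans : transitive R.
Hypothesis Rper : forall x y, R (x + m) (y + m) = R x y.
Hypothesis R2 : forall x, R x (x + 2 * m).
Hypothesis Rnc : forall a b c d, a < b -> b < c -> c < d -> d < a + 2 * m ->
  R a c -> R b d -> R a b.

(** Here [x + 2 * m - t] stands for [x - t], which may be negative. *)
Definition back x t := (t < m) && R (x + 2 * m - t) x.

(** A block is central when the half turn fixes it. Any other block fits in a window of length [m],
    so its farthest element less than [m] behind [x] is its first. *)
Definition roff x : option nat :=
  if R x (x + m) then None else Some (\max_(t < m | back x t) t).

Lemma Rper2 x y : R (x + 2 * m) y = R x y.
Proof.
by apply/idP/idP; apply: Rtrans; rewrite ?R2 // Rsym R2.
Qed.

Lemma Rper2r x y : R x (y + 2 * m) = R x y.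
Proof. by rewrite Rsym Rper2 Rsym. Qed.

Lemma roff_some x t : roff x = Some t ->
  [/\ ~~ R x (x + m), back x t & forall s, back x s -> s <= t].
Proof.
rewrite /roff; case: ifP => // Rx [<-]; split=> //.
  have [|i Pi ->] := eq_bigmax_cond (fun t : 'I_m => nat_of_ord t)
     (A := [pred t : 'I_m | back x t]); last by [].
  apply/card_gt0P; exists (Ordinal m0); rewrite inE /back /= m0 subn0 Rper2.
  exact: Rrefl.
move=> s bs; have sm : s < m by case/andP: bs.
exact: (@leq_bigmax_cond _ _ (fun t : 'I_m => nat_of_ord t) (Ordinal sm)).
Qed.

Lemma roff_per x : roff (x + m) = roff x.
Proof.
rewrite /roff Rper; case: ifP => // _; congr Some; apply: eq_bigl => t.
rewrite /back; congr andb; rewrite -(Rper _ x); congr R; have := ltn_ord t; lia.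
Qed.

Lemma R_addm x y : R x y -> R (x + m) (y + m).
Proof. by rewrite Rper. Qed.

Lemma zero_same x y : R x y -> R x (x + m) -> R y (y + m).
Proof.
move=> xy xm; apply: Rtrans (R_addm xy); apply: Rtrans xm; by rewrite Rsym.
Qed.

Lemma roff_nested : nested m roff.
Proof.
split=> [|x t /roff_some[_ /andP[]]//|y z u]; first exact: roff_per.
case/andP=> yz' /eqP/roff_some[nz /andP[zm]].
have -> : z + 2 * m - (z - y) = y + 2 * m by lia.
rewrite Rper2 => yz mx /andP[yu uz].
have [uzR|nuz] := boolP (R u z).
  have nu : ~~ R u (u + m) by apply: contra nz; apply: zero_same.
  case E: (roff u) => [r|]; last by move: E; rewrite /roff (negbTE nu).
  have [_ /andP[rm bu] _] := roff_some E.
  suff ru : r <= u - y.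
    by exists (u - r); [lia|rewrite /opens leq_subr E subKn ?eqxx //; lia].
  rewrite leqNgt; apply/negP => ltr; pose p := u + 2 * m - r.
  have pz : R p z by apply: Rtrans uzR.
  have [lt|ge] := ltnP (z - u + r) m.
    have := mx (z - u + r); rewrite /back lt /=.
    have -> : z + 2 * m - (z - u + r) = p by rewrite /p; lia.
    by move=> /(_ pz); lia.
  have npm : p + m != z + 2 * m.
    apply: contra nz => /eqP E2; have := R_addm pz; rewrite E2 Rper2 //.
  (* The block of [u] and [z] and its image under the half turn interleave at these points;
     noncrossing merges them, which makes [u] central. *)
  have := @Rnc (u + 2 * m) (p + m) (z + 2 * m) (z + 3 * m).
  rewrite Rper2 Rper2r uzR.
  have -> : R (p + m) (z + 3 * m) by have := R_addm pz; rewrite -Rper2r; congr R; lia.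
  move=> H; have : R u (p + m).
    have := H; rewrite Rper2; apply => //; rewrite /p in npm *; lia.
  move=> h; case/negP: nu; apply: Rtrans h _; rewrite Rper; exact: bu.
(* Now [u] lies in another block, strictly under the arc. If that block were central or reached back
   past [y], it would cross the block of [y] and [z]. *)
have yu' : y < u by rewrite ltn_neqAle yu andbT; apply: contraNneq nuz => <-.
have uz' : u < z by rewrite ltn_neqAle uz andbT; apply: contraNneq nuz => ->.
have nyu : ~ R y u by move=> h; case/negP: nuz; apply: Rtrans yz; rewrite Rsym.
have nu : ~~ R u (u + m).
  by apply/negP => h; apply: nyu; apply: (Rnc _ _ _ _ yz h); lia.
case E: (roff u) => [r|]; last by move: E; rewrite /roff (negbTE nu).
have [_ /andP[rm bu] _] := roff_some E.
suff ru : r <= u - y.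
  by exists (u - r); [lia|rewrite /opens leq_subr E subKn ?eqxx //; lia].
rewrite leqNgt; apply/negP => ltr; apply: nyu.
by apply: (@Rnc y u z (u + 2 * m - r)) => //; try lia; rewrite Rsym.
Qed.

Lemma roff_opens a x : opens roff a x -> R a x.
Proof.
case/andP=> ax /eqP/roff_some[_ /andP[_]].
by have -> : x + 2 * m - (x - a) = a + 2 * m by [lia]; rewrite Rper2.
Qed.

Lemma R_mod x y : x = y %[mod 2 * m] -> R x y.
Proof.
have Rm z : R (z %% (2 * m)) z.
  rewrite [in X in R _ X](divn_eq z (2 * m)) addnC; elim: (_ %/ _) => [|c IH].
    by rewrite addn0.
  by rewrite (mulSn c) [2 * m + _]addnC addnA Rper2r.
by move=> E; apply: Rtrans (Rm y); rewrite -E Rsym.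
Qed.

Lemma roff_max a c x : opens roff a x -> R c x -> c <= x < c + m -> a <= c.
Proof.
case/andP=> ax /eqP/roff_some[_ _ mx] cx /andP[h1 h2].
have := mx (x - c); rewrite /back.
have -> : x + 2 * m - (x - c) = c + 2 * m by lia.
by rewrite Rper2 cx => h; have := h _; lia.
Qed.

Lemma roff_key_close x y : x <= y < x + m -> R x y -> okey roff x = okey roff y.
Proof.
move=> /andP[xy yx] Rxy; have no := roff_nested.
have [zx|nzx] := boolP (R x (x + m)).
  by have zy := zero_same Rxy zx; rewrite /okey /roff zx zy.
have nzy : ~~ R y (y + m).
  by apply: contra nzx; apply: zero_same; rewrite Rsym.
rewrite -(okey_per x) // -(okey_per y) //.
case Ex: (okey roff (x + 2 * m)) => [k|]; last first.
  by move/eqP: Ex; rewrite okey_none /roff [x + 2 * m + m]addnAC Rper2 Rper2r (negbTE nzx).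
case Ey: (okey roff (y + 2 * m)) => [j|]; last first.
  by move/eqP: Ey; rewrite okey_none /roff [y + 2 * m + m]addnAC Rper2 Rper2r (negbTE nzy).
have [|a ax <-] := okey_some no _ Ex; first by lia.
have [|b bY <-] := okey_some no _ Ey; first by lia.
have bx : b <= x + 2 * m by apply: roff_max bY _ _; [rewrite Rper2 Rper2r|lia].
have ba : b <= a by apply: (opens_between no bY ax); lia.
have ab : a <= b.
  apply: (roff_max ax); last by have := opens_lt no bY; lia.
  by rewrite Rper2r; apply: Rtrans (roff_opens bY) _; rewrite Rper2 Rsym.
by congr (Some (_ %% _)); lia.
Qed.

Lemma roff_key x y : R x y = (okey roff x == okey roff y).
Proof.
have no := roff_nested.
have reduce (Q : nat -> nat -> Prop) :
    (forall x y y', y = y' %[mod 2 * m] -> Q x y' -> Q x y) ->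
    (forall x y, x <= y < x + 2 * m -> Q x y) -> Q x y.
  move=> Qm Qw; have [y' [h1 h2]] : exists y', y = y' %[mod 2 * m] /\ x <= y' < x + 2 * m.
    pose c := 2 * m; exists (x + (y + x * (c.-1)) %% c); split; last first.
      have : (y + x * c.-1) %% c < c by rewrite ltn_pmod // /c; lia.
      by rewrite -/c; lia.
    rewrite -/c modnDmr addnCA -mulnS prednK; last by rewrite /c; lia.
    by rewrite addnC modnMDl.
  by apply: (Qm _ _ _ h1); apply: Qw.
apply: (reduce (fun x y => R x y = (okey roff x == okey roff y))).
  move=> x1 y1 y' E; rewrite (okey_mod no E) => <-.
  by apply/idP/idP => h; apply: Rtrans h _; apply: R_mod.
clear reduce x y; move=> x y xy; apply/idP/eqP => [Rxy|].
  have [lt|ge] := ltnP y (x + m); first by apply: roff_key_close; rewrite ?lt //; lia.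
  have [E|ne] := eqVneq y (x + m).
    by rewrite E in Rxy *; rewrite /okey roff_per /roff Rxy.
  rewrite -(okey_per x) //; apply/esym/roff_key_close; first by lia.
  by rewrite Rper2r Rsym.
case Ex: (okey roff x) => [k|] E.
  rewrite -okey_per // in Ex; rewrite -okey_per // in E.
  have [|a ax Ea] := okey_some no _ Ex; first by lia.
  have [|b bY Eb] := okey_some no _ (esym E); first by lia.
  have := roff_opens ax; have := roff_opens bY; rewrite !Rper2r => Rb Ra.
  apply: Rtrans Rb; rewrite Rsym in Ra; apply: Rtrans Ra _; apply: R_mod.
  by rewrite Ea Eb.
(* Two blocks fixed by the half turn contain crossing diameters, hence coincide. *)
have zx : R x (x + m) by move/eqP: Ex; rewrite okey_none /roff; case: (R _ _).
have zy : R y (y + m).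
  by move/esym/eqP: E; rewrite okey_none /roff; case: (R _ _).
have [->|ne] := eqVneq y x; first exact: Rrefl.
have [E1|ne1] := eqVneq y (x + m); first by rewrite E1.
have [lt|ge] := ltnP y (x + m); first by apply: (Rnc _ _ _ _ zx zy); lia.
apply: (Rtrans zx); apply: (@Rnc _ _ (x + 2 * m) (y + m)) => //; try lia.
by have -> : x + 2 * m = x + m + m by [lia]; rewrite Rper.
Qed.

End Encode.

End Lifts.

(** * Invariant noncrossing partitions *)

Section Partitions.
Variables k n : nat.
Local Notation m := (mm k n).
Local Notation T := ('I_(2 * mm k n)).
Hypothesis m0 : 0 < m.
Local Notation off := (off m0).
Local Notation centered := (centered m0).
Local Notation nestedb := (nestedb m0).
Local Notation sizes := (sizes m0).

Lemma double_gt0 : 0 < 2 * m. Proof. by rewrite muln_gt0. Qed.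

Definition tord x : T := Ordinal (ltn_pmod x double_gt0).

Lemma tordK (x : T) : tord x = x.
Proof. by apply: val_inj; rewrite /= modn_small. Qed.

Lemma rho_tord x : rho (tord x) = tord (x + m).
Proof. by apply: val_inj; rewrite /= modnDml. Qed.

Lemma tord2 x : tord (x + 2 * m) = tord x.
Proof. by apply: val_inj; rewrite /= modnDr. Qed.

Lemma rhoK : involutive (@rho m).
Proof.
move=> x; rewrite -[x]tordK !rho_tord -addnA addnn -mul2n tord2 //.
Qed.

Definition key (e : model m) (x : T) := okey m (off e) x.

Definition decode e : {set {set T}} := preim_partition (key e) [set: T].

Definition invariant_nc (P : {set {set T}}) :=
  [&& partition P [set: T], noncrossing P & [set (@rho m) @: B | B : {set T} in P] == P].

Definition fiber e (x : T) := [set y : T | key e y == key e x].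

Lemma decodeP e B : reflect (exists x, B = fiber e x) (B \in decode e).
Proof.
apply: (iffP imsetP) => [[x _ ->]|[x ->]]; exists x => //; apply/setP => y;
  by rewrite !inE eq_sym.
Qed.

Lemma key_tord e x : nestedb e -> key e (tord x) = okey m (off e) x.
Proof. by move/nestedP=> ne; apply: okey_mod => //=; rewrite modn_mod. Qed.

Lemma okeyDm o x : nested m o ->
  okey m o (x + m) = omap (fun c => (c + m) %% (2 * m)) (okey m o x).
Proof.
move=> [per lt _]; rewrite /okey per; case E: (o x) => [t|] //=.
by rewrite modnDml; congr (Some (_ %% _)); have := lt _ _ E; lia.
Qed.

Lemma key_rho e x : nestedb e ->
  key e (rho x) = omap (fun c => (c + m) %% (2 * m)) (key e x).
Proof.
move=> ne; rewrite -[x]tordK rho_tord !key_tord // okeyDm //; exact/nestedP.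
Qed.

Lemma key_lt e x c : key e x = Some c -> c < 2 * m.
Proof. by rewrite /key /okey; case: (off e x) => //= t [<-]; rewrite ltn_pmod ?double_gt0. Qed.

Lemma rho_fiber e x : nestedb e -> (@rho m) @: fiber e x = fiber e (rho x).
Proof.
move=> ne; have sub y z : key e y = key e z -> key e (rho y) = key e (rho z).
  by move=> E; rewrite !key_rho // E.
apply/setP => y; rewrite inE; apply/imsetP/eqP => [[z]|E].
  by rewrite inE => /eqP E ->; apply: sub.
by exists (rho y); rewrite ?rhoK // inE; apply/eqP; rewrite (sub _ _ E) rhoK.
Qed.

Lemma decode_partition e : partition (decode e) [set: T].
Proof. exact: preim_partitionP. Qed.

Lemma decode_invariant_nc e : nestedb e -> invariant_nc (decode e).
Proof.
move=> ne; have /nestedP no := ne.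
apply/and3P; split; first exact: decode_partition.
  apply/forallP => B; apply/implyP => /decodeP[x ->].
  apply/forallP => B'; apply/implyP => /decodeP[y ->]; apply/implyP => neq.
  apply/forallP => a; apply/forallP => b; apply/forallP => c; apply/forallP => d.
  apply/negP => /and5P[ab bc cd]; rewrite !inE => /eqP ax /and3P[/eqP cx /eqP bY /eqP dy].
  case/negP: neq; apply/eqP/setP => z; rewrite !inE.
  have -> // : key e x = key e y.
  rewrite -ax -bY /key -(okey_per m0 a no) -(okey_per m0 b no).
  apply: (@okey_noncrossing m m0 _ _ _ (c + 2 * m) (d + 2 * m)) => //; try lia.
  - by have := ltn_ord d; lia.
  - by rewrite !okey_per //; move: ax cx; rewrite /key => -> ->.
  - by rewrite !okey_per //; move: bY dy; rewrite /key => -> ->.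
apply/eqP/setP => B; apply/imsetP/decodeP => [[B' /decodeP[x ->] ->]|[x ->]].
  by exists (rho x); rewrite rho_fiber.
exists (fiber e (rho x)); first by apply/decodeP; exists (rho x).
by rewrite rho_fiber // rhoK.
Qed.

Lemma decode_refines e1 e2 : nestedb e1 -> nestedb e2 ->
  refines (decode e1) (decode e2) <-> coarser (off e1) (off e2).
Proof.
move=> n1 n2; have /nestedP o1 := n1; have /nestedP o2 := n2.
rewrite -(okey_coarser m0 o1 o2); split=> [/forallP h x y E|K].
  have := h (fiber e1 (tord x)) => /implyP H.
  have [|C /andP[/decodeP[z ->] /subsetP S]] := existsP (H _).
    by apply/decodeP; exists (tord x).
  have : tord x \in fiber e2 z by apply: S; rewrite inE.
  have : tord y \in fiber e2 z by apply: S; rewrite inE !key_tord // E.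
  by rewrite !inE !key_tord // => /eqP-> /eqP->.
apply/forallP => B; apply/implyP => /decodeP[x ->]; apply/existsP.
exists (fiber e2 x); apply/andP; split; first by apply/decodeP; exists x.
by apply/subsetP => y; rewrite !inE => /eqP/K E; apply/eqP.
Qed.

Lemma coarser_anti e1 e2 : nestedb e1 -> nestedb e2 ->
  coarser (off e1) (off e2) -> coarser (off e2) (off e1) -> e1 = e2.
Proof.
move=> /nestedP n1 /nestedP n2.
have sub f g : nested m (off f) -> coarser (off f) (off g) -> coarser (off g) (off f) ->
    forall a x, opens (off f) a x -> opens (off g) a x.
  move=> nf [c1 _] [d1 d2] a x ax; have [b bx] := d2 _ _ ax.
  have ba : opens (off g) b a by rewrite (c1 _ _ ax).
  have : opens (off f) a b by rewrite (d1 _ _ bx).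
  by move/opens_le => h; have -> : a = b by have := opens_le ba; lia.
move=> c12 c21; apply/(@off_inj _ m0)/opens_eq_off => a x.
by apply/idP/idP; apply: sub.
Qed.

Lemma refines_refl (P : {set {set T}}) : refines P P.
Proof. by apply/forallP => B; apply/implyP => ?; apply/existsP; exists B; apply/andP. Qed.

Lemma decode_inj e1 e2 : nestedb e1 -> nestedb e2 -> decode e1 = decode e2 -> e1 = e2.
Proof.
move=> n1 n2 E; apply: coarser_anti => //; apply/decode_refines => //; rewrite E;
  exact: refines_refl.
Qed.

(** The linear condition is cyclic: bringing the window at [a] back to [[0, 2m)] rotates the four
    points, and the cases count how many of them pass the cut at [q + 2 * m]. *)
Lemma noncrossing_lifted (P : {set {set T}}) B B' a b c d : noncrossing P ->
  B \in P -> B' \in P -> a < b -> b < c -> c < d -> d < a + 2 * m ->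
  tord a \in B -> tord c \in B -> tord b \in B' -> tord d \in B' -> B = B'.
Proof.
move=> nc; have nc4 C C' w x y z : C \in P -> C' \in P -> w < x -> x < y -> y < z -> z < 2 * m ->
    tord w \in C -> tord y \in C -> tord x \in C' -> tord z \in C' -> C = C'.
  move=> PC PC' wx xy yz zm wC yC xC' zC'; apply/eqP/negP => /negP neq.
  have := nc => /forallP/(_ C)/implyP/(_ PC)/forallP/(_ C')/implyP/(_ PC')/implyP/(_ neq).
  move=> /forallP/(_ (tord w))/forallP/(_ (tord x))/forallP/(_ (tord y))/forallP/(_ (tord z)).
  by rewrite wC yC xC' zC' /= !modn_small ?wx ?xy ?yz //; lia.
move=> PB PB'; have [q aq tq] : exists2 q, q <= a < q + 2 * m &
    forall x, q <= x -> tord (x - q) = tord x.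
  exists (a %/ (2 * m) * (2 * m)).
    by rewrite leq_trunc_div -mulSnr ltn_ceil ?double_gt0.
  move=> x qx; apply: val_inj; rewrite /= -[in RHS](subnK qx).
  by rewrite addnC modnMDl.
have tq2 x : q + 2 * m <= x -> tord (x - q - 2 * m) = tord x.
  by move=> h; rewrite -(tq x) -?(tord2 (_ - _ - _)) ?subnK //; lia.
move=> ab bc cd da aB cB bB' dB'.
have [h1|h1] := ltnP d (q + 2 * m).
  by apply: (@nc4 _ _ (a - q) (b - q) (c - q) (d - q)); rewrite ?tq //; lia.
have [h2|h2] := ltnP c (q + 2 * m).
  apply/esym; apply: (@nc4 _ _ (d - q - 2 * m) (a - q) (b - q) (c - q));
    rewrite ?tq2 ?tq //; lia.
have [h3|h3] := ltnP b (q + 2 * m).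
  apply: (@nc4 _ _ (c - q - 2 * m) (d - q - 2 * m) (a - q) (b - q));
    rewrite ?tq2 ?tq //; lia.
apply/esym; apply: (@nc4 _ _ (b - q - 2 * m) (c - q - 2 * m) (d - q - 2 * m) (a - q));
  rewrite ?tq2 ?tq //; lia.
Qed.

Lemma decode_onto P : invariant_nc P -> exists2 e, nestedb e & decode e = P.
Proof.
case/and3P => partP nc /eqP inv; have /and3P[/eqP covP triv n0] := partP.
have cov x : x \in cover P by rewrite covP inE.
pose R x y := pblock P (tord x) == pblock P (tord y).
have RP x y B : B \in P -> tord x \in B -> R x y = (tord y \in B).
  by move=> PB xB; rewrite /R eq_pblock // (def_pblock triv PB xB).
have Rrefl : reflexive R by move=> x; rewrite /R.
have Rsym : symmetric R by move=> x y; rewrite /R eq_sym.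
have Rtrans : transitive R by move=> y x z /eqP E1 /eqP E2; rewrite /R E1 E2.
have R2 x : R x (x + 2 * m) by rewrite /R tord2.
have Rm x y : R x y -> R (x + m) (y + m).
  move=> Rxy; have PB : pblock P (tord x) \in P by apply: pblock_mem.
  have xB : tord x \in pblock P (tord x) by rewrite mem_pblock.
  have rB : (@rho m) @: pblock P (tord x) \in P.
    by have := imset_f (fun B : {set T} => (@rho m) @: B) PB; rewrite inv.
  rewrite (RP _ _ _ rB) -rho_tord; apply: imset_f => //.
  by rewrite -(RP _ _ _ PB xB).
have Rper x y : R (x + m) (y + m) = R x y.
  apply/idP/idP; last exact: Rm.
  by move/Rm; rewrite /R -!addnA addnn -mul2n !tord2.
have Rnc a b c d : a < b -> b < c -> c < d -> d < a + 2 * m -> R a c -> R b d -> R a b.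
  move=> ab bc cd da Rac Rbd.
  have PB x : pblock P (tord x) \in P by apply: pblock_mem.
  have xB x : tord x \in pblock P (tord x) by rewrite mem_pblock.
  apply/eqP; apply: (noncrossing_lifted nc _ _ ab bc cd da) => //.
    by rewrite -(RP _ _ _ (PB a) (xB a)).
  by rewrite -(RP _ _ _ (PB b) (xB b)).
have no := roff_nested m0 Rrefl Rsym Rtrans Rper R2 Rnc.
have Rkey := roff_key m0 Rrefl Rsym Rtrans Rper R2 Rnc.
have [e Ee] := off_exists m0 no.
have ne : nestedb e.
  apply/nestedP; split; [exact: off_per|exact: off_lt|move=> y z u].
  rewrite /opens Ee => h1 h2; have [_ _ /(_ y z u h1 h2)[y' ? ?]] := no.
  by exists y' => //; rewrite /opens Ee.
exists e => //; rewrite -[RHS](equivalence_partition_pblock partP).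
have keyR (x y : T) : (key e x == key e y) = (y \in pblock P x).
  rewrite /key /okey !Ee -/(okey m _ x) -/(okey m _ y) -Rkey /R !tordK eq_pblock //.
apply/setP => B; apply/imsetP/imsetP => -[x _ ->]; exists x; rewrite ?inE //;
  by apply/setP => y; rewrite !inE /= keyR.
Qed.

End Partitions.

(** * Pairs of opposite blocks and divisibility of block sizes *)

Section BlockPairs.
Variables k n : nat.
Local Notation m := (mm k n).
Local Notation T := ('I_(2 * mm k n)).
Hypothesis m0 : 0 < m.
Local Notation off := (off m0).
Local Notation centered := (centered m0).
Local Notation nestedb := (nestedb m0).
Local Notation sizes := (sizes m0).
Local Notation tord := (tord m0).
Local Notation key := (key m0).
Local Notation fiber := (fiber m0).
Local Notation decode := (decode m0).

Lemma fiber_opener e (y : 'I_m) : nestedb e -> 0 < owidth m (off e) y ->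
  key e (tord y) = Some (y : nat).
Proof.
move=> ne w; have /nestedP no := ne; rewrite key_tord //.
by rewrite (okey_opens m0 (owidth_opens no w)) modn_small //; have := ltn_ord y; lia.
Qed.

Lemma card_fiber e (y : 'I_m) : nestedb e -> 0 < owidth m (off e) y ->
  #|fiber e (tord y)| = owidth m (off e) y.
Proof.
move=> ne w; have ky := fiber_opener ne w; have ym := ltn_ord y.
have -> : owidth m (off e) y = #|[set i : 'I_m | off e (y + i) == Some (i : nat)]|.
  rewrite owidthE big_mkord -sum1_card [RHS]big_mkcond.
  by apply: eq_bigr => i _; rewrite inE.
rewrite -(@card_in_imset _ _ (fun i : 'I_m => tord (y + i))); last first.
  move=> i j _ _ /(congr1 val)/eqP /=; rewrite eqn_modDl !modn_small; last 2 first.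
  - by have := ltn_ord j; lia.
  - by have := ltn_ord i; lia.
  by move/eqP/val_inj.
apply: eq_card => x; rewrite inE ky; apply/eqP/imsetP => [|[i]].
  rewrite /key /okey; case E: (off e x) => [t|] //= -[Et].
  have tm := off_lt E.
  have yt : (y + t) %% (2 * m) = x.
    by rewrite -Et modnDml subnK ?modnDr ?modn_small //; lia.
  exists (Ordinal tm); last by apply: val_inj; rewrite /= yt.
  rewrite inE /= -E; apply/eqP; rewrite -[in RHS]yt.
  by have -> : off e ((y + t) %% (2 * m)) = off e (y + t); last by [];
    apply: (@per_mod (2 * m)) => z; apply: per_mul; apply: off_per.
rewrite inE => /eqP Ei ->; rewrite key_tord // /okey Ei /= -[in RHS](modn_small (m := y) (d := 2 * m)).
  by rewrite -[in RHS]modnDr; congr (Some (_ %% _)); have := ltn_ord i; lia.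
lia.
Qed.

(** A noncentral block opens in one half of the circle; if it is the second half, the half turn
    brings the opener into [[0, m)]. *)
Lemma opener_of_fiber e x : nestedb e -> key e x <> None ->
  exists2 y : 'I_m, 0 < owidth m (off e) y &
    fiber e x = fiber e (tord y) \/ fiber e x = (@rho m) @: fiber e (tord y).
Proof.
move=> ne; have /nestedP no := ne; case Ex: (key e x) => [c|] // _.
have c2 := key_lt Ex.
have Ex2 : okey m (off e) (x + 2 * m) = Some c by rewrite okey_per.
have [|a ax Ea] := okey_some m0 no _ Ex2; first by lia.
have wa : 0 < owidth m (off e) a.
  rewrite owidthE (bigD1_seq 0) ?iota_uniq ?mem_index_iota //= addn0.
  by have := opens_self no ax; rewrite /opens subnn leqnn /= => ->.
have per : forall z, owidth m (off e) (z + m) = owidth m (off e) z.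
  by move=> z; apply: owidth_per; apply: off_per.
have ym : c %% m < m by rewrite ltn_pmod.
have wy : 0 < owidth m (off e) (Ordinal ym).
  by rewrite /= -Ea modn_dvdm ?(dvdn_mull 2 (dvdnn m)) // (per_mod a per).
exists (Ordinal ym) => //; have ky := fiber_opener ne wy.
rewrite rho_fiber //; have [cm|mc] := ltnP c m; [left|right]; apply/setP => z;
  rewrite !inE Ex ?key_rho // ky /=; congr (_ == Some _).
  by rewrite modn_small.
have -> : c %% m = c - m by rewrite -[in LHS](subnK mc) modnDr modn_small //; lia.
by rewrite subnK // modn_small.
Qed.

Lemma rho_fiber_neq e (y : 'I_m) : nestedb e -> 0 < owidth m (off e) y ->
  (@rho m) @: fiber e (tord y) != fiber e (tord y).
Proof.
move=> ne w; have ky := fiber_opener ne w; have ym := ltn_ord y; rewrite rho_fiber //.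
apply/eqP => /setP/(_ (tord y)); rewrite !inE key_rho // ky /= eqxx.
by rewrite modn_small; [case: eqP => // -[]; lia|lia].
Qed.

(** Each pair of opposite blocks has exactly one opener in [[0, m)]. The predicate lets one count
    serve both [pnum] and [typei]. *)
Lemma card_block_pairs e (pr : pred nat) : nestedb e ->
  #|[set [set B; (@rho m) @: B] | B : {set T} in decode e & ((@rho m) @: B != B) && pr #|B|]|
  = count pr (sizes e).
Proof.
move=> ne; have no := nestedP _ _ ne.
pose O := [set y : 'I_m | (0 < owidth m (off e) y) && pr (owidth m (off e) y)].
pose pair (y : 'I_m) : {set {set T}} := [set fiber e (tord y); (@rho m) @: fiber e (tord y)].
have -> : count pr (sizes e) = #|O|.
  rewrite /sizes /letters count_filter /widths count_map -sum1_count -sum1_card.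
  rewrite -{1}[m]subn0 -/(index_iota 0 m) big_mkord; apply: eq_bigl => y.
  by rewrite [in RHS]inE andbC.
rewrite -(@card_in_imset _ _ pair O); last first.
  move=> y z; rewrite !inE => /andP[wy _] /andP[wz _] E.
  have ky := fiber_opener ne wy; have kz := fiber_opener ne wz.
  have : fiber e (tord y) \in pair z by rewrite -E !inE eqxx.
  rewrite !inE rho_fiber // => /orP[] /eqP/setP/(_ (tord y)); rewrite !inE eqxx.
    by rewrite ky kz => /esym/eqP[] /val_inj.
  rewrite key_rho // ky kz /= => /esym/eqP[]; rewrite modn_small.
    by have := ltn_ord y; lia.
  by have := ltn_ord z; lia.
have img (B : {set T}) : (@rho m) @: ((@rho m) @: B) = B.
  rewrite -imset_comp (eq_imset (g := id)) ?imset_id // => x /=; exact: rhoK.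
apply: eq_card => Q; apply/imsetP/imsetP => [[B]|[y]].
  rewrite inE => /andP[/decodeP[x ->] /andP[nz prB]] ->.
  have kx : key e x <> None.
    move=> E; case/eqP: nz; rewrite rho_fiber //; apply/setP => z.
    by rewrite !inE key_rho // E.
  have [y wy Ey] := opener_of_fiber ne kx; exists y; last first.
    by case: Ey => ->; rewrite /pair ?img // setUC.
  rewrite inE wy -card_fiber //.
  case: Ey prB => -> //; rewrite card_imset //; exact: (can_inj (rhoK m0)).
rewrite inE => /andP[wy pry] ->; exists (fiber e (tord y)) => //.
rewrite inE rho_fiber_neq // card_fiber // pry !andbT.
by apply/decodeP; exists (tord y).
Qed.

Lemma pnum_decode e : nestedb e -> pnum (decode e) = size (sizes e).
Proof.
move=> ne; rewrite -[RHS]count_predT -card_block_pairs // /pnum.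
congr #|pred_of_set _|; apply/setP => Q; apply/imsetP/imsetP => -[B];
  by rewrite inE => h ->; exists B => //; move: h; rewrite !inE ?andbT.
Qed.

Lemma typei_decode e i : nestedb e -> typei (decode e) i = count_mem (2 * k * i) (sizes e).
Proof.
move=> ne; rewrite -card_block_pairs //.
Qed.

(** The central block is what the others leave of [2 * m] elements, and [2 * k] divides [2 * m]. *)
Lemma decode_dvd e : nestedb e -> (forall y : 'I_m, 2 * k %| owidth m (off e) y) ->
  forall B, B \in decode e -> 2 * k %| #|B|.
Proof.
move=> ne dv B BP.
have dvS x : key e x <> None -> 2 * k %| #|fiber e x|.
  move=> kx; have [y wy] := opener_of_fiber ne kx.
  by case=> ->; rewrite ?(card_imset _ (can_inj (rhoK m0))) card_fiber.
have /decodeP[x Ex] := BP; case kx: (key e x) => [c|]; first by rewrite Ex dvS // kx.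
have := card_partition (decode_partition m0 e); rewrite cardsT card_ord (bigD1 B) //= => E.
have dv2m : 2 * k %| 2 * m by rewrite dvdn_pmul2l // dvdn_mulr.
suff dvR : 2 * k %| \sum_(C in decode e | C != B) #|C| by rewrite -(dvdn_addl _ dvR) -E.
apply: dvdn_sum => C /andP[/decodeP[z ->] neq]; apply: dvS => kz.
by case/eqP: neq; rewrite Ex; apply/setP => u; rewrite !inE kx kz.
Qed.

Lemma ncTE (P : {set {set T}}) :
  ncT P = invariant_nc P && [forall B in P, 2 * k %| #|B|].
Proof. by rewrite /ncT /invariant_nc -!andbA; do 4!congr andb; rewrite andbC. Qed.

(** A block of [Q] is a disjoint union of blocks of [P]. *)
Lemma refines_dvd (P Q : {set {set T}}) : partition P [set: T] -> partition Q [set: T] ->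
  refines P Q -> [forall B in P, 2 * k %| #|B|] -> [forall B in Q, 2 * k %| #|B|].
Proof.
move=> pP pQ /forallP rPQ /forallP dP; apply/forallP => C; apply/implyP => QC.
have /and3P[/eqP covP trivP _] := pP; have /and3P[_ trivQ _] := pQ.
have -> : #|C| = \sum_(B in P) \sum_(x in B | x \in C) 1.
  rewrite -big_trivIset_cond // -/(cover P) covP -sum1_card.
  by apply: eq_bigl => x; rewrite inE.
apply: dvdn_sum => B PB; have /existsP[D /andP[QD BD]] := implyP (rPQ B) PB.
have dB := implyP (dP B) PB; have [E|ne] := eqVneq D C.
  rewrite (eq_bigl (mem B)) ?sum1_card // => x /=.
  by rewrite andb_idr // -E => /(subsetP BD).
rewrite big_pred0 ?dvdn0 // => x; apply/negP => /andP[/(subsetP BD) xD xC].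
by case/eqP: ne; rewrite -(def_pblock trivQ QD xD) (def_pblock trivQ QC xC).
Qed.

Lemma dvd_centered e : 0 < k -> nestedb e -> [forall B in decode e, 2 * k %| #|B|] -> centered e.
Proof.
move=> k0 ne /forallP dv; rewrite centered_sum //.
have no := nestedP _ _ ne; have tot := owidth_total no.
rewrite -[X in _ < X]tot -[X in X < _]addn0 ltn_add2l lt0n; apply/eqP => Z.
rewrite Z addn0 big_mkord in tot.
have : 2 * k %| m.
  rewrite -[X in _ %| X]tot; apply: dvdn_sum => y _.
  have [->|wy] := posnP (owidth m (off e) y).
    exact: dvdn0.
  rewrite -card_fiber //; have := implyP (dv (fiber e (tord y))); apply.
  by apply/decodeP; exists (tord y).
rewrite /mm mulnC dvdn_pmul2l // dvdn2 addn1 /= oddM //.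
Qed.

End BlockPairs.

(** * Counting chains *)

Lemma big_tuple_cons (X : finType) l (G : l.+1.-tuple X -> nat) :
  \sum_(c : l.+1.-tuple X) G c = \sum_(x : X) \sum_(t : l.-tuple X) G [tuple of x :: t].
Proof.
rewrite pair_big /=.
rewrite (reindex (fun p : X * l.-tuple X => [tuple of p.1 :: p.2])) //=.
exists (fun t => (thead t, [tuple of behead t])) => [[x t] _|t _] /=.
  by congr pair; apply: val_inj.
by rewrite [RHS]tuple_eta; apply: val_inj.
Qed.

Section ChainSum.
Variables (X : finType) (A : pred X) (le : rel X) (p : X -> nat).

Definition below q (F : X -> nat) y := \sum_(x | [&& A x, le x y & p x == q]) F x.

(** The smallest element is summed out first: [below q] turns a weight on it into a weight on the
    next element of the chain. *)
Fixpoint chain_sum q qs (F : X -> nat) : nat :=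
  if qs is q' :: qs' then chain_sum q' qs' (below q F) else \sum_(x | A x && (p x == q)) F x.

Lemma chain_sumE l q qs (F : X -> nat) : size qs = l ->
  \sum_(c : l.+1.-tuple X | [&& all A c, sorted le c & map p c == q :: qs]) F (thead c)
  = chain_sum q qs F.
Proof.
elim: l q qs F => [|l IHl] q [|q' qs] F //=.
  move=> _; rewrite big_mkcond big_tuple_cons [RHS]big_mkcond; apply: eq_bigr => x _.
  rewrite (bigD1 [tuple]) //= big1 ?addn0 => [|t]; last by rewrite tuple0.
  by rewrite andbT eqseq_cons eqxx andbT theadE.
case=> sq; rewrite -IHl // big_mkcond big_tuple_cons exchange_big [RHS]big_mkcond /=.
apply: eq_bigr => c _; case: (tupleP c) => y t; rewrite /below !theadE /=.
rewrite -big_mkcond /=; case: ifP => [/and3P[/andP[Ay At] pt /eqP Et]|H].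
  by apply: eq_bigl => x; rewrite Ay At pt /= Et eqseq_cons eqxx !andbT.
rewrite big_pred0 // => x; apply/negP => /and3P[/and3P[_ Ay At] /andP[_ pt]].
rewrite eqseq_cons => /andP[_ Et].
by move: H; rewrite Ay At pt Et.
Qed.

End ChainSum.

(** * Sequences with prescribed content *)

Section Content.
Variables (M n : nat) (g : nat -> nat).
Hypothesis g_inj : forall i j, 0 < i <= n -> 0 < j <= n -> g i = g j -> i = j.
Hypothesis g_lt : forall i, 0 < i <= n -> 0 < g i < M.

(** Letters outside the range of [g] are excluded by [full_count] once the prescribed counts add up
    to the length of [d]. *)
Definition content (bs : nat -> nat) (d : seq nat) :=
  all (fun i => count_mem (g i) d == bs i) (index_iota 1 n.+1).

Lemma contentP bs d :
  reflect (forall i, 0 < i <= n -> count_mem (g i) d = bs i) (content bs d).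
Proof.
apply: (iffP allP) => [h i hi|h i]; first by apply/eqP/h; rewrite mem_index_iota.
by rewrite mem_index_iota => hi; apply/eqP/h.
Qed.

Lemma sum_pick (G : nat -> nat) i : 0 < i <= n ->
  \sum_(1 <= j < n.+1) (g i == g j) * G j = G i.
Proof.
move=> hi; rewrite (bigD1_seq i) ?iota_uniq ?mem_index_iota //= eqxx mul1n.
rewrite big1_seq ?addn0 // => j /andP[ne]; rewrite mem_index_iota => hj.
by case: eqP => // /(g_inj hi hj) E; rewrite E eqxx in ne.
Qed.

Lemma sum_pick_none (G : nat -> nat) x : (forall i, 0 < i <= n -> x <> g i) ->
  \sum_(1 <= j < n.+1) (x == g j) * G j = 0.
Proof.
by move=> h; rewrite big1_seq // => j; rewrite mem_index_iota => /h; case: eqP.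
Qed.

Lemma in_range x : (exists2 i, 0 < i <= n & x = g i) \/ (forall i, 0 < i <= n -> x <> g i).
Proof.
case: (boolP (has (fun i => x == g i) (index_iota 1 n.+1))) => [/hasP[i]|/hasPn h].
  by rewrite mem_index_iota => hi /eqP->; left; exists i.
by right=> i hi E; have := h i; rewrite mem_index_iota E eqxx => /(_ hi).
Qed.

Lemma sum_count d : \sum_(1 <= i < n.+1) count_mem (g i) d <= size d.
Proof.
elim: d => [|x d IHd]; first by rewrite big1.
rewrite /= big_split /= -[(size d).+1]add1n leq_add //.
case: (in_range x) => [[i hi ->]|h].
  by rewrite -[X in _ <= X](sum_pick (fun=> 1) hi) leq_sum // => j _; rewrite muln1.
by rewrite -[X in X <= _](eq_bigr _ (fun j _ => muln1 _)) (sum_pick_none (fun=> 1) h).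
Qed.

Lemma full_count d : size d <= \sum_(1 <= i < n.+1) count_mem (g i) d ->
  sumn d = \sum_(1 <= i < n.+1) g i * count_mem (g i) d /\
  (forall x, x \in d -> exists2 i, 0 < i <= n & x = g i).
Proof.
elim: d => [|x d IHd] /=.
  by move=> _; split=> //; rewrite big1 // => i _; rewrite muln0.
rewrite big_split /=; case: (in_range x) => [[i hi xi]|h].
  have -> : \sum_(1 <= j < n.+1) (x == g j) = 1.
    by rewrite -[RHS](sum_pick (fun=> 1) hi); apply: eq_bigr => j _; rewrite xi muln1.
  rewrite add1n ltnS => /IHd[-> inr]; split=> [|y].
    rewrite (eq_bigr _ (fun j _ => mulnDr _ _ _)) big_split /=; congr addn.
    rewrite xi -[LHS](sum_pick g hi); apply: eq_bigr => j _; exact: mulnC.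
  by rewrite inE => /orP[/eqP->|/inr//]; exists i.
have -> : \sum_(1 <= j < n.+1) (x == g j) = 0.
  by rewrite -[RHS](sum_pick_none (fun=> 1) h); apply: eq_bigr => j _; rewrite muln1.
by rewrite add0n => h'; have := sum_count d; rewrite leqNgt h'.
Qed.

Lemma sum_range (G : nat -> nat) : (forall x, (forall i, 0 < i <= n -> x <> g i) -> G x = 0) ->
  \sum_(x < M | 0 < x) G x = \sum_(1 <= i < n.+1) G (g i).
Proof.
move=> G0; transitivity (\sum_(x < M | 0 < x) \sum_(1 <= i < n.+1) (nat_of_ord x == g i) * G (g i)).
  apply: eq_bigr => x _; case: (in_range x) => [[i hi ->]|h].
    by rewrite (sum_pick (fun j => G (g j)) hi).
  by rewrite G0 // (sum_pick_none (fun j => G (g j)) h).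
rewrite exchange_big /= !big_nat; apply: eq_bigr => i hi.
have /andP[gp gM] := g_lt hi.
rewrite (bigD1 (Ordinal gM)) //= eqxx mul1n big1 ?addn0 // => x /andP[_].
by rewrite -val_eqE /= => /negbTE->.
Qed.

(** A first letter [g i] lowers [bs i] by one, matching the expansion of [b.+1] factorial as the sum
    of the [bs i] times [b] factorial. *)
Lemma content_count b bs : \sum_(1 <= i < n.+1) bs i = b ->
  psum M b (fun d => content bs d : nat) * \prod_(1 <= i < n.+1) (bs i)`! = b`!.
Proof.
have too_short bs' d : size d < \sum_(1 <= i < n.+1) bs' i -> content bs' d = false.
  move=> lt; apply/negP => /contentP E; have := sum_count d; rewrite leqNgt => /negP[].
  by rewrite (eq_big_nat _ _ (F2 := bs')).
elim: b bs => [|b IHb] bs Sb.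
  have z i : 0 < i <= n -> bs i = 0.
    move=> hi; move/eqP: Sb; rewrite sum_nat_seq_eq0 => /allP/(_ i) /=.
    by rewrite mem_index_iota => /(_ hi)/eqP.
  rewrite /= (introT (contentP bs [::])) => [|i hi]; last by rewrite z.
  by rewrite mul1n big1_seq // => i; rewrite mem_index_iota /= => hi; rewrite z.
pose dec i j := bs j - (j == i).
have content_cons i d : 0 < i <= n ->
    content bs (g i :: d) = (0 < bs i) && content (dec i) d.
  move=> hi; apply/contentP/andP => [E|[b0 /contentP E] j hj].
    have bi := E i hi; rewrite /= eqxx in bi; split; first by rewrite -bi.
    apply/contentP => j hj; rewrite /dec -(E j hj) /=.
    have [->|ne] := eqVneq j i; first by rewrite eqxx addKn.
    have -> : (g i == g j) = false by apply/eqP => /(g_inj hi hj) ij; rewrite ij eqxx in ne.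
    by rewrite subn0.
  rewrite /= (E j hj) /dec; have [->|ne] := eqVneq j i; first by rewrite eqxx; lia.
  have -> : (g i == g j) = false by apply/eqP => /(g_inj hi hj) ij; rewrite ij eqxx in ne.
  by rewrite subn0.
rewrite /= (sum_range (G := fun x => psum M b (fun d => content bs (x :: d) : nat))); last first.
  move=> x h; rewrite -[RHS](psum0 M b); apply: eq_psum => d sd _.
  have -> : content bs (x :: d) = content bs d; last by rewrite too_short // sd Sb.
  apply: eq_in_all => i; rewrite mem_index_iota /= => hi.
  by have -> : (x == g i) = false by apply/eqP/h.
rewrite factS -Sb !big_distrl /= big_nat [RHS]big_nat; apply: eq_bigr => i hi.
have [b0|bpos] := posnP (bs i).
  rewrite b0 mul0n (_ : psum _ _ _ = 0) ?mul0n // -[RHS](psum0 M b).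
  by apply: eq_psum => d _ _; rewrite content_cons // b0.
rewrite (@eq_psum M b _ (fun d => content (dec i) d : nat)); last first.
  by move=> d _ _; rewrite content_cons // bpos.
have S' : \sum_(1 <= j < n.+1) dec i j = b.
  have im : i \in index_iota 1 n.+1 by rewrite mem_index_iota.
  move: Sb; rewrite !(bigD1_seq i) ?iota_uniq //= /dec eqxx.
  rewrite [X in _ -> _ + X = _](eq_bigr bs); last by move=> j /negbTE->; rewrite subn0.
  by lia.
have im : i \in index_iota 1 n.+1 by rewrite mem_index_iota.
rewrite -(IHb _ S') mulnCA; congr (_ * _).
rewrite !(bigD1_seq i) ?iota_uniq //= mulnA /dec eqxx; congr (_ * _).
  by rewrite subn1 -{1}(prednK bpos) factS prednK.
by apply: eq_bigr => j /negbTE->; rewrite subn0.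
Qed.

End Content.

Lemma seg_sumn cs w : seg cs w -> sumn cs < size w.
Proof.
elim: cs w => [|c cs IH] w /=; first exact: leq_ltn_trans.
by move=> /andP[_ /IH]; rewrite size_drop; lia.
Qed.

(** This is [cutsum] at full length: [seg] forces the bound of [bsum] on [cs], since a position must
    remain beyond the segments. *)
Lemma bsum_finer_sum m b b' f : b' <= b ->
  bsum m b' 0 m (finer_sum m b f) = 'C(m, b - b') * bsum m b 0 m f.
Proof.
move=> le; have [_ cut] := @open_cut_sum m m (leqnn m).
have := cut b' b f; rewrite /binom_gap le => <-.
apply: eq_psum => cs _ _; rewrite /finer_sum; case: ltnP => lt; first by rewrite mul1n.
rewrite mul0n -(wsum0 m m); apply: eq_wsum => w sw.
by case E: (seg cs w) => //; have := seg_sumn E; rewrite sw; lia.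
Qed.

(** * Sums along chains of partitions *)

Section Chains.
Variables k n : nat.
Local Notation m := (mm k n).
Local Notation T := ('I_(2 * mm k n)).
Hypothesis m0 : 0 < m.
Local Notation off := (off m0).
Local Notation centered := (centered m0).
Local Notation sizes := (sizes m0).
Local Notation decode := (decode m0).

Definition is_decoded (P : {set {set T}}) := [exists e, centered e && (decode e == P)].

(** The invariant carried up the chain: a weight that depends on the block sizes only, in whatever
    order they are listed. *)
Definition realizes (F : {set {set T}} -> nat) (f : seq nat -> nat) :=
  forall e s, centered e -> perm_eq s (sizes e) -> F (decode e) = f s.

Lemma centered_nested e : centered e -> nestedb m0 e.
Proof. by case/andP. Qed.

Lemma sum_decoded (Q : pred {set {set T}}) F :
  \sum_(P | is_decoded P && Q P) F P = \sum_(e | centered e && Q (decode e)) F (decode e).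
Proof.
pose enc P := odflt [ffun=> None] [pick e | centered e && (decode e == P)].
have encK P : is_decoded P -> centered (enc P) /\ decode (enc P) = P.
  rewrite /enc => /existsP[e0 he0]; case: pickP => [e /andP[? /eqP] //|/(_ e0)].
  by rewrite he0.
rewrite (reindex_onto decode enc) /=; last by move=> P /andP[/encK[]].
apply: eq_bigl => e; apply/andP/andP => [[/andP[dP QP] /eqP E]|[ge QP]].
  by have [g _] := encK _ dP; rewrite E in g.
have de : is_decoded (decode e) by apply/existsP; exists e; rewrite ge eqxx.
split; first by rewrite de.
have [g E] := encK _ de; apply/eqP; apply: (@decode_inj k n m0) E; exact: centered_nested.
Qed.

Lemma realizes_below q F f : realizes F f ->
  realizes (below is_decoded (@refines k n) (@pnum k n) q F) (finer_sum m q f).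
Proof.
move=> Ff e s ge ps; rewrite /below sum_decoded.
rewrite -(@sum_finer _ m0 (fun e1 => refines (decode e1) (decode e))
  (fun e1 => F (decode e1)) f e q s) //.
- apply: eq_bigl => e1; case ge1: (centered e1) => //=.
  by rewrite pnum_decode // centered_nested.
- by move=> e1 ge1; apply: decode_refines; apply: centered_nested.
Qed.

Fixpoint jumps q qs :=
  if qs is q' :: qs' then 'C(m, q - q') * jumps q' qs' else 'C(m, q).

Lemma chain_sum_jumps q qs F f : realizes F f -> sorted geq (q :: qs) ->
  chain_sum is_decoded (@refines k n) (@pnum k n) q qs F = jumps q qs * bsum m q 0 m f.
Proof.
elim: qs q F f => [|q' qs IH] q F f Ff /=; last first.
  case/andP=> qq' so; rewrite (IH _ _ (finer_sum m q f)) //; last exact: realizes_below.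
  by rewrite bsum_finer_sum // mulnA [_ * 'C(_, _)]mulnC.
move=> _; rewrite sum_decoded.
(* Everything refines the all-central structure, so the sum over the largest element is also a sum
   over refinements, with empty size sequence. *)
pose top : model m := [ffun=> None].
have offt x : off top x = None by rewrite [LHS]/(omap val _) ffunE.
have nt : nestedb m0 top.
  by apply/nestedP; split=> [x|x t|y z u]; rewrite /opens !offt ?andbF.
have gt' : centered top.
  by rewrite /centered nt; apply/existsP; exists (Ordinal m0); rewrite ffunE.
have st : sizes top = [::].
  rewrite /sizes /letters; apply/eqP; rewrite -[_ == _]negbK -has_filter has_map.
  apply/hasPn => y _ /=; rewrite owidthE big1 // => i _; by rewrite offt.
have := @bsum_finer_sum m q 0 f (leq0n q); rewrite subn0 => <-.
rewrite /bsum /= m0 mul1n.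
rewrite -(@sum_finer _ m0 predT (fun e1 => F (decode e1)) f top q [::]) ?st //.
- apply: eq_bigl => e1; case ge1: (centered e1) => //=.
  by rewrite pnum_decode // centered_nested.
- move=> e1 ge1; split=> // _; split=> [a x _ b|b x]; by rewrite /opens !offt !andbF.
Qed.

Lemma decoded_ncT (P : {set {set T}}) : 0 < k -> ncT P -> is_decoded P.
Proof.
move=> k0; rewrite ncTE => /andP[/(decode_onto m0)[e ne Ee] dv]; apply/existsP; exists e.
by rewrite Ee eqxx andbT; apply: dvd_centered; rewrite ?Ee.
Qed.

(** The noncentral sizes, one per pair, are at least [2k] and sum to less than [k(2n+1)]. Hence the
    subtraction in [rank] does not truncate and [rank] determines [pnum]. *)
Lemma ncT_pnum (P : {set {set T}}) : 0 < k -> ncT P -> pnum P <= n.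
Proof.
move=> k0 PT; have /existsP[e /andP[ge /eqP Ee]] := decoded_ncT k0 PT.
have ne := centered_nested ge; move: PT; rewrite ncTE -Ee => /andP[_ /forallP dv].
rewrite (pnum_decode ne).
have big x : x \in sizes e -> 2 * k <= x.
  rewrite mem_filter => /andP[x0 /mapP[y]]; rewrite mem_iota => ym Ex.
  rewrite Ex in x0 *; apply: dvdn_leq => //; rewrite -[y]/(nat_of_ord (Ordinal ym)).
  rewrite -card_fiber //; have := implyP (dv (fiber m0 e (tord m0 (Ordinal ym)))); apply.
  by apply/decodeP; exists (tord m0 (Ordinal ym)).
have lt : sumn (sizes e) < m.
  by rewrite sumn_letters sumn_widths -centered_sum.
have le : 2 * k * size (sizes e) <= sumn (sizes e).
  elim: (sizes e) big => [|x s IH] h /=; first by rewrite muln0.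
  rewrite mulnS leq_add ?h ?mem_head //; apply: IH => y ys; apply: h.
  by rewrite inE ys orbT.
have := leq_ltn_trans le lt; move: (size _) => x.
rewrite /mm -mulnA mulnCA ltn_pmul2l //; lia.
Qed.

Lemma refines_trans : transitive (@refines k n).
Proof.
move=> Q P S /forallP h1 /forallP h2; apply/forallP => B; apply/implyP => PB.
have /existsP[C /andP[QC BC]] := implyP (h1 B) PB.
have /existsP[D /andP[SD CD]] := implyP (h2 C) QC.
by apply/existsP; exists D; rewrite SD (subset_trans BC).
Qed.

Lemma multichain_sorted l (c : l.-tuple {set {set T}}) :
  [forall i : 'I_l, forall j : 'I_l, (i <= j) ==> refines (tnth c i) (tnth c j)]
  = sorted (@refines k n) c.
Proof.
apply/idP/idP => [/forallP h|so].
  apply/(sortedP set0) => i; rewrite size_tuple => il.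
  have := h (Ordinal (ltnW il)) => /forallP/(_ (Ordinal il))/implyP/(_ (leqnSn i)).
  by rewrite !(tnth_nth set0).
apply/forallP => i; apply/forallP => j; apply/implyP => ij; rewrite !(tnth_nth set0).
apply: (sorted_leq_nth refines_trans _ set0 so) => //; try by rewrite inE size_tuple.
by move=> P; apply: refines_refl.
Qed.

End Chains.

(* [telescope_rank] inverts the truncated differences of the rank jump vector: the total
   of the jumps leaves no room for a decrease of the rank. *)
Lemma telescope_rank (n l : nat) (s r : nat -> nat) :
  \sum_(1 <= j < l.+3) s j = n -> (forall j, r j <= n) -> r 1 = s 1 ->
  (forall j, 1 < j <= l.+1 -> r j - r j.-1 = s j) -> n - r l.+1 = s l.+2 ->
  forall j, 0 < j <= l.+1 -> r j = \sum_(1 <= i < j.+1) s i.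
Proof.
move=> Sn rn r1 rj rl.
have up j : 0 < j <= l.+1 -> r j <= \sum_(1 <= i < j.+1) s i.
  case: j => // j /= jl; elim: j jl => [|j IH] jl; first by rewrite big_nat1 r1.
  rewrite big_nat_recr //= -(rj j.+2) //=; have := IH (ltnW jl); lia.
have down d : d <= l -> \sum_(1 <= i < (l.+1 - d).+1) s i <= r (l.+1 - d).
  elim: d => [|d IH] dl.
    by have := rn l.+1; move: Sn; rewrite subn0 big_nat_recr //=; lia.
  have := IH (ltnW dl); have -> : l.+1 - d = (l.+1 - d.+1).+1 by lia.
  rewrite big_nat_recr //=; have := rj (l.+1 - d.+1).+1; move=> /=; lia.
move=> j hj; apply/eqP; rewrite eqn_leq up //=.
have := down (l.+1 - j); have -> : l.+1 - (l.+1 - j) = j by lia.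
by apply; lia.
Qed.

(** A sequence of this content sums to [2k] times the sum of the [i * bs i], at most [2kn], hence
    meets the bound of [bsum]. *)
Lemma multinomial_psum M n k b (bs : nat -> nat) : 0 < k -> 2 * k * n < M ->
  \sum_(1 <= i < n.+1) bs i = b -> \sum_(1 <= i < n.+1) i * bs i <= n ->
  bsum M b 0 M (content n (fun i => 2 * k * i) bs) = multinomial b bs n.
Proof.
move=> k0 nM Sb Sib.
have g_inj i j : 0 < i <= n -> 0 < j <= n -> 2 * k * i = 2 * k * j -> i = j.
  by move=> _ _ /eqP; rewrite eqn_pmul2l ?muln_gt0 // => /eqP.
have g_lt i : 0 < i <= n -> 0 < 2 * k * i < M.
  case/andP=> i0 ii; rewrite !muln_gt0 k0 i0 /=; apply: leq_ltn_trans nM.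
  by rewrite leq_pmul2l ?muln_gt0.
rewrite /multinomial -(content_count g_inj g_lt Sb) mulnK; last first.
  by apply: prodn_gt0 => i; exact: fact_gt0.
apply: eq_psum => d sd _; case: (boolP (content _ _ _ d)) => [/contentP E|]; last by rewrite muln0.
rewrite muln1 add0n; suff -> : sumn d < M by [].
have [|-> _] := full_count g_inj (d := d).
  by rewrite (eq_big_nat _ _ (F2 := bs)) // Sb sd.
apply: leq_ltn_trans nM.
rewrite (eq_big_nat _ _ (F2 := fun i => 2 * k * (i * bs i))); last first.
  by move=> i hi; rewrite E // mulnA.
by rewrite -big_distrr leq_mul2l Sib orbT.
Qed.

(** The numbers of pairs along the chain are tail sums of the jump vector, so their differences are
    the jumps. *)
Lemma jumps_prod k n l (s : nat -> nat) j r : j + r = l ->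
  jumps k n (\sum_(j.+1 <= i < l.+2) s i)
    [seq \sum_(h.+1 <= i < l.+2) s i | h <- iota j.+1 r] =
  \prod_(j.+1 <= i < l.+2) 'C(mm k n, s i).
Proof.
elim: r j => [|r IH] j jl /=.
  by have -> : l = j by [lia]; rewrite !big_nat1.
rewrite IH; last by lia.
by rewrite big_ltn 1?[RHS]big_ltn ?addnK //; lia.
Qed.

Theorem theorem6p2 (n k l b : nat) (bs s : nat -> nat) :
  0 < n -> 0 < k -> 0 < l ->
  \sum_(1 <= i < n.+1) bs i = b ->
  \sum_(1 <= i < n.+1) i * bs i <= n ->
  \sum_(1 <= j < l.+2) s j = n ->
  s 1 = n - b ->
  #|[set c : l.-tuple {set {set 'I_(2 * mm k n)}} |
      [&& multichain c,
          [forall j : 'I_l.+2, (0 < j) ==> (rjv c j == s j)],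
          typeb (pij c 1) == b &
          [forall i : 'I_n.+1, (0 < i) ==> (typei (pij c 1) i == bs i)]]]|
  = multinomial b bs n * \prod_(2 <= j < l.+2) 'C(2 * k * n + k, s j).
Proof.
move=> n0 k0; case: l => // l _ Sb Sib Sn s1.
have m0 : 0 < mm k n by rewrite muln_gt0 k0 addn1.
(* This makes [s 1 = n - b] an honest difference, so that the remaining jumps add up to [b]. *)
have bn : b <= n.
  rewrite -Sb; apply: leq_trans Sib; rewrite !big_nat; apply: leq_sum => i /andP[i0 _].
  exact: leq_pmull.
(* The number of pairs of noncentral blocks required of the [j]-th partition: [n] minus its rank. *)
pose Q j := \sum_(j.+1 <= i < l.+3) s i.
have SQ j : j <= l.+1 -> \sum_(1 <= i < j.+1) s i + Q j = n.
  by move=> jl; rewrite -big_cat_nat //=; lia.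
have Q1 : Q 1 = b by have := SQ 1; rewrite big_nat1 s1; lia.
pose F (P : {set {set 'I_(2 * mm k n)}}) : nat :=
  [forall i : 'I_n.+1, (0 < i) ==> (typei P i == bs i)].
pose f d : nat := content n (fun i => 2 * k * i) bs d.
have Ff : @realizes k n m0 F f.
  move=> e t ge pt; rewrite /F /f; congr nat_of_bool; apply/forallP/contentP => h i.
    move=> /andP[i0 ii]; have lt : i < n.+1 by [].
    have := implyP (h (Ordinal lt)) i0; rewrite typei_decode ?centered_nested // => /eqP<-.
    exact: permP.
  apply/implyP => i0; rewrite typei_decode ?centered_nested // -h; last first.
    by rewrite i0 -ltnS /=.
  by apply/eqP/esym/permP.
have mE : mm k n = 2 * k * n + k by rewrite /mm; lia.
rewrite -mE; pose qs := [seq Q j | j <- iota 2 l].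
transitivity (chain_sum (@is_decoded k n m0) (@refines k n) (@pnum k n) (Q 1) qs F); last first.
  rewrite (chain_sum_jumps Ff) /qs; last first.
    rewrite -[_ :: _]/[seq Q j | j <- iota 1 l.+1].
    apply/(sortedP 0) => i; rewrite size_map size_iota => il.
    rewrite !(nth_map 0) ?size_iota // 1?ltnW // !nth_iota // 1?ltnW //.
    have := SQ i.+1 (ltnW il); have := SQ i.+2 il; rewrite big_nat_recr //= !add1n; lia.
  rewrite (@jumps_prod k n l.+1 s 1 l) // Q1 mulnC; congr (_ * _).
  by apply: multinomial_psum; rewrite // mE; lia.
rewrite -(@chain_sumE _ _ _ _ l) ?size_map ?size_iota //.
rewrite -sum1_card big_mkcond [RHS]big_mkcond; apply: eq_bigr => c _.
have pijE j : 0 < j <= l.+1 -> pij c j \in c.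
  by move=> hj; rewrite mem_nth // size_tuple; lia.
have c1E : pij c 1 = thead c by rewrite /thead (tnth_nth set0).
(* The same chains are selected by divisibility and rank jumps as by central blocks and numbers of
   pairs, once the type at the bottom is fixed. *)
suff -> : (c \in [set c : l.+1.-tuple {set {set 'I_(2 * mm k n)}} |
      [&& multichain c,
          [forall j : 'I_l.+3, (0 < j) ==> (rjv c j == s j)],
          typeb (pij c 1) == b &
          [forall i : 'I_n.+1, (0 < i) ==> (typei (pij c 1) i == bs i)]]]) =
   [&& all (@is_decoded k n m0) c, sorted (@refines k n) c & map (@pnum k n) c == Q 1 :: qs]
    && (F (thead c) == 1).
  by rewrite /F; case: (all _ _ && _); case: [forall i, _].
have FE (P : {set {set 'I_(2 * mm k n)}}) : (F P == 1) = [forall i : 'I_n.+1, (0 < i) ==> (typei P i == bs i)].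
  by rewrite /F; case: [forall i, _].
have pnums : (map (@pnum k n) c == Q 1 :: qs) <->
    (forall j, 0 < j <= l.+1 -> pnum (pij c j) = Q j).
  rewrite -[_ :: _]/[seq Q j | j <- iota 1 l.+1]; split=> [/eqP E j hj|E].
    have := congr1 (fun t => nth 0 t j.-1) E.
    rewrite (nth_map set0) ?size_tuple; last by lia.
    rewrite (nth_map 0) ?size_iota ?nth_iota; try lia.
    by move=> ->; congr Q; lia.
  apply/eqP/(@eq_from_nth _ 0) => [|i]; rewrite !size_map ?size_tuple ?size_iota // => il.
  by rewrite (nth_map set0) ?size_tuple // (nth_map 0) ?size_iota // nth_iota // -E.
rewrite inE /multichain multichain_sorted FE c1E.
have nc_pn (P : {set {set 'I_(2 * mm k n)}}) : ncT P -> pnum P = n - rank P.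
  by move=> PT; have := ncT_pnum m0 k0 PT; rewrite /rank; lia.
apply/idP/idP.
  case/and4P => /andP[/forallP cT so] /forallP rj _ ty; rewrite ty andbT so /=.
  have cin (P : {set {set 'I_(2 * mm k n)}}) : P \in c -> ncT P by case/tnthP => i ->.
  rewrite (introT allP) /=; last by move=> P /cin; apply: decoded_ncT.
  apply/pnums => j hj; rewrite nc_pn ?cin ?pijE //.
  have rjE h : 0 < h <= l.+2 -> rjv c h = s h.
    case/andP=> h0 hl; have lt : h < l.+3 by [].
    exact/eqP/(implyP (rj (Ordinal lt))).
  rewrite (@telescope_rank n l s (fun h => rank (pij c h))) //.
  - by have := SQ j; lia.
  - by move=> h; rewrite leq_subr.
  - by rewrite -rjE.
  - move=> h /andP[h1 hl]; rewrite -rjE; last by lia.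
    by rewrite /rjv; case: eqP => [|_]; [lia|rewrite hl].
  - by rewrite -rjE /rjv ?ltnn //; lia.
case/andP => /and3P[/allP cA so /pnums pn] ty; rewrite ty andbT so andbT.
have tyE i : 0 < i <= n -> typei (thead c) i = bs i.
  move=> /andP[i0 ii]; have lt : i < n.+1 by [].
  exact/eqP/(implyP (forallP ty (Ordinal lt))).
have -> : typeb (thead c) == b.
  by rewrite /typeb (eq_big_nat _ _ (F2 := bs)) // Sb.
have inv (P : {set {set 'I_(2 * mm k n)}}) : P \in c -> invariant_nc P.
  by move/cA => /existsP[e /andP[ge /eqP<-]]; apply: decode_invariant_nc; apply: centered_nested ge.
(* The prescribed counts of the sizes [2ki] already add up to [b], the number of all noncentral
   sizes, so no other size occurs. *)
have dv1 : [forall B in thead c, 2 * k %| #|B|].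
  have /existsP[e /andP[ge /eqP Ee]] : @is_decoded k n m0 (thead c) by apply/cA/mem_tnth.
  have ne := centered_nested ge; rewrite -Ee; apply/forallP => B; apply/implyP.
  apply: (decode_dvd ne) => y; have [->|wy] := posnP (owidth (mm k n) (off m0 e) y).
    exact: dvdn0.
  have g_inj i j : 0 < i <= n -> 0 < j <= n -> 2 * k * i = 2 * k * j -> i = j.
    by move=> _ _ /eqP; rewrite eqn_pmul2l ?muln_gt0 // => /eqP.
  have [|_ /(_ (owidth (mm k n) (off m0 e) y))] := full_count g_inj (d := sizes m0 e).
    rewrite -(pnum_decode ne) Ee -c1E pn // Q1 -Sb.
    by rewrite (eq_big_nat _ _ (F2 := bs)) // => i hi; rewrite -typei_decode // Ee tyE.
  rewrite mem_filter wy map_f ?mem_iota ?ltn_ord //= => /(_ isT)[i _ ->].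
  exact: dvdn_mulr.
have cT (P : {set {set 'I_(2 * mm k n)}}) : P \in c -> ncT P.
  move=> Pc; rewrite ncTE inv //=.
  have /and3P[p1 _ _] := inv _ (mem_tnth ord0 c); have /and3P[pP _ _] := inv _ Pc.
  apply: refines_dvd dv1 => //; have [i ->] := tnthP _ _ Pc.
  rewrite -(multichain_sorted) in so.
  exact: (implyP (forallP (forallP so ord0) i)).
rewrite andbT; apply/andP; split; first by apply/forallP => i; apply/cT/mem_tnth.
apply/forallP => j; apply/implyP => j0; apply/eqP.
have rk h : 0 < h <= l.+1 -> rank (pij c h) = n - Q h by move=> hh; rewrite /rank pn.
have jl := ltn_ord j; rewrite /rjv.
case: eqP => [->|/eqP j1]; first by rewrite rk // Q1 s1.
case: leqP => jl1.
  rewrite !rk; [|lia|lia]; have := SQ j; have := SQ j.-1.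
  rewrite prednK // => h1 h2; have := h2 jl1; rewrite big_nat_recr //=.
  by have := h1 (leq_trans (leq_pred _) jl1); lia.
have -> : nat_of_ord j = l.+2 by lia.
have QL : Q l.+1 = s l.+2 by rewrite /Q big_nat1.
by have := SQ l.+1 (leqnn _); rewrite rk ?leqnn // QL; lia.
Qed.
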